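(* Let $F:\mathbb{R}^2\times\mathbb{R}^2\to\mathbb{R}$ satisfy, for all $p,q,q_1,q_2$: $F$ is continuous; $F(p,\cdot)$ is convex; $F(p,\lambda q)=\lambda F(p,q)$ for $\lambda>0$; $m_1|q|\le F(p,q)\le m_2|q|$ for some $m_1,m_2>0$. Suppose there exists a continuous $F_\infty:\mathbb{R}^2\times\mathbb{R}^2\to\mathbb{R}$ with $F_\infty(p+n,q)=F_\infty(p,q)$ for all $n\in\mathbb{Z}^2$, and such that for every $q\in\mathbb{R}^2$, $F(p,q)-F_\infty(p,q)\to0$ as $|p|\to+\infty$. Then for every $\tau\in\mathbb{R}$, $S_F(\tau)\le S_{F_\infty}(\tau)$. Moreover, if for a fixed $\tau\in\mathbb{R}$ one has $S_F(\tau)<S_{F_\infty}(\tau)$, then there exists a Lipschitz continuous $u_\tau\in\mathcal{M}_\tau$ with $\mathcal{F}(u_\tau)=S_F(\tau)$.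
   Context: $W^{1,1}$ is the space of $1$-periodic maps in $W^{1,1}_{loc}(\mathbb{R};\mathbb{R}^2)$. For a Lagrangian $G$, $\mathcal{G}(u)=\int_0^1G(u,\dot u)\,dt$; $\mathcal{A}(u)=\frac12\int_0^1u\cdot i\dot u\,dt$ with $ip$ the rotation of $p$ by $\pi/2$; $\mathcal{M}_\tau=\{u\in W^{1,1}:\mathcal{A}(u)=\tau\}$ and $S_G(\tau)=\inf_{\mathcal{M}_\tau}\mathcal{G}$. In particular $\mathcal{F}$ and $S_F$, $S_{F_\infty}$ are defined this way. *)

(* Defs.v *)
From HB Require Import structures.
From mathcomp Require Import all_boot all_order all_algebra.
From mathcomp Require Import all_classical all_reals all_analysis.
Set Implicit Arguments. Unset Strict Implicit. Unset Printing Implicit Defensive.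
Import Order.TTheory GRing.Theory Num.Theory numFieldNormedType.Exports.
Local Open Scope classical_set_scope.
Local Open Scope ring_scope.

Section Defs.
Variable R : realType.
Notation mu := (@lebesgue_measure R).

Definition enorm (p : R * R) : R := Num.sqrt (p.1 ^+ 2 + p.2 ^+ 2).
Definition rot (p : R * R) : R * R := (- p.2, p.1).
Definition dotp (p q : R * R) : R := p.1 * q.1 + p.2 * q.2.

Definition vel (u : R -> R * R) (t : R) : R * R :=
  (derive1 (fun s => (u s).1) t, derive1 (fun s => (u s).2) t).

(* a real function is W^{1,1}_loc (continuous representative): its derivative
   is integrable on every compact interval and it is the indefinite integral
   of it, i.e. it is locally absolutely continuous *)
Definition W11loc_R (f : R -> R) : Prop :=
  forall a b : R, a <= b ->
    mu.-integrable `[a, b] (EFin \o derive1 f) /\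
    f b - f a = Rintegral mu `[a, b] (derive1 f).

Definition W11 (u : R -> R * R) : Prop :=
  (forall t, u (t + 1) = u t) /\
  W11loc_R (fun s => (u s).1) /\ W11loc_R (fun s => (u s).2).

Definition lagr (G : R * R -> R * R -> R) (u : R -> R * R) : \bar R :=
  (\int[mu]_(t in `[0%R, 1%R]) (G (u t) (vel u t))%:E)%E.

Definition area (u : R -> R * R) : \bar R :=
  ((2^-1)%:E * \int[mu]_(t in `[0%R, 1%R]) (dotp (u t) (rot (vel u t)))%:E)%E.

Definition Mtau (tau : R) : set (R -> R * R) :=
  [set u | W11 u /\ area u = tau%:E].

Definition Sval (G : R * R -> R * R -> R) (tau : R) : \bar R :=
  ereal_inf [set lagr G u | u in Mtau tau].

Definition lipschitz_curve (u : R -> R * R) : Prop :=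
  exists L : R, forall s t, enorm ((u s).1 - (u t).1, (u s).2 - (u t).2) <= L * `|s - t|.

End Defs.

(* Main.v *)
(* Direct method, with every passage to the limit made on Riemann-type sums
   sum_i G (u t_i) (u t_(i+1) - u t_i), where G is continuous and sublinear in its
   second argument.  By Jensen these sums are at most int G(u, u') plus an error
   controlled by the oscillation of u on the cells; for a Lipschitz curve on the
   uniform grid they converge to int G(u, u') (a.e. differentiability and dominated
   convergence); they are pointwise continuous in u and do not see the
   parametrization.  Hence, if W^{1,1} curves u_n of bounded length are
   reparametrized by arclength and v is a pointwise limit along an ultrafilter,
   then v is Lipschitz and int G(v, v') <= lim int G(u_n, u_n'), without any change
   of variables.  Taking G = F gives lower semicontinuity, and G = +/- cross
   product gives convergence of the areas.
   Both S_F <= S_Finf (integer translations to infinity) and the boundedness of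
   minimizing sequences when S_F < S_Finf rest on |F - Finf| <= e |q| for |p| large,
   uniformly in q. *)

Require Import Defs.
From HB Require Import structures.
From mathcomp Require Import all_boot all_order all_algebra.
From mathcomp Require Import all_classical all_reals all_analysis.
From mathcomp Require Import measurable_realfun ring lra.
Import Order.TTheory GRing.Theory Num.Theory numFieldNormedType.Exports.
Local Open Scope classical_set_scope.
Local Open Scope ring_scope.

(** * Sublinear Lagrangians *)

Section sublinear.
Context {R : realType}.
Implicit Types (p q : R * R) (G : R * R -> R * R -> R).

(** Minimizing sequences are bounded only in W^{1,1}, where velocities may concentrate;
    reparametrization is the remedy, and one-homogeneity makes it free. The reparametrized curves
    are only shown to be Lipschitz: their energy is never written as an integral, because their
    increments over a uniform grid are increments of the original curves over another partition.
    Jensen is thus needed for W^{1,1} curves alone, and convergence of the sums for the Lipschitz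
    limit alone. The price is that this limit must be admissible for the total function [derive1];
    hence the section on differentiability of Lipschitz functions. Convexity and homogeneity are
    assumed for [F] only; [Finf] receives them as a limit of integer translates of [F]. *)

Definition l1norm q : R := `|q.1| + `|q.2|.

(** Convexity appears as subadditivity, and homogeneity includes the factor 0, so that
    [G p (0, 0) = 0]. No sign is imposed: the class must contain [F], [Finf] and both signs of the
    area integrand. *)
Definition sublinear_lagrangian G := [/\
  continuous (fun z : (R * R) * (R * R) => G z.1 z.2),
  forall p q1 q2, G p (q1.1 + q2.1, q1.2 + q2.2) <= G p q1 + G p q2 &
  forall p q (l : R), 0 <= l -> G p (l * q.1, l * q.2) = l * G p q].

Lemma l1norm_ge0 q : 0 <= l1norm q.
Proof. by rewrite /l1norm addr_ge0. Qed.

Lemma l1norm_eq0 q : l1norm q = 0 -> q = (0, 0).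
Proof.
case: q => x y /eqP; rewrite /l1norm paddr_eq0//= !normr_eq0.
by move=> /andP[/eqP -> /eqP ->].
Qed.

(** Hahn-Banach in the plane, in a single extension step: [(x, y)] and [(- y, x)] form a basis as
    soon as [(x, y)] is nonzero. *)
Lemma sublinear_support_nz (h : R -> R -> R) (x y : R) :
  (forall x1 y1 x2 y2, h (x1 + x2) (y1 + y2) <= h x1 y1 + h x2 y2) ->
  (forall l x y, 0 <= l -> h (l * x) (l * y) = l * h x y) ->
  0 < x ^+ 2 + y ^+ 2 ->
  exists a b : R, (forall u v, a * u + b * v <= h u v) /\ a * x + b * y = h x y.
Proof.
move=> hD hZ r0; set r := x ^+ 2 + y ^+ 2 in r0.
have h00 : h 0 0 = 0 by have := hZ 0 0 0 (lexx 0); rewrite !mul0r.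
have hs s : s * h x y <= h (s * x) (s * y).
  have [s0|s0] := leP 0 s; first by rewrite hZ.
  have := hD (s * x) (s * y) (- s * x) (- s * y).
  rewrite (hZ (- s)); last by rewrite oppr_ge0 ltW.
  rewrite -!mulrDl subrr !mul0r h00; lra.
(* The functional is prescribed on (x, y); its value c on the orthogonal vector
   (- y, x) must lie above S and below the quantities bounded in Sub. *)
pose S := [set z | exists s, z = s * h x y - h (s * x + y) (s * y - x)].
have Sub s : ubound S (h (s * x - y) (s * y + x) - s * h x y).
  move=> _ [s' ->].
  have := hD (s * x - y) (s * y + x) (s' * x + y) (s' * y - x).
  have := hs (s + s').
  rewrite (_ : s * x - y + (s' * x + y) = (s + s') * x); last by ring.
  rewrite (_ : s * y + x + (s' * y - x) = (s + s') * y); last by ring.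
  lra.
have S0 : S !=set0 by exists (0 * h x y - h (0 * x + y) (0 * y - x)); exists 0.
have hS : has_sup S by split => //; eexists; exact: (Sub 0).
pose c := sup S.
have cub s : c <= h (s * x - y) (s * y + x) - s * h x y by apply: ge_sup.
have clb s : s * h x y - h (s * x + y) (s * y - x) <= c.
  by apply: ub_le_sup; [exact: hS.2|exists s].
(* Dividing by [|t|] reduces the bound to coefficient 1 or -1 of [(- y, x)], that is, to [cub] or
   [clb]. *)
have key s t : s * h x y + t * c <= h (s * x - t * y) (s * y + t * x).
  have [t0|t0|->] := ltgtP t 0; last first.
  - by rewrite !mul0r subr0 !addr0.
  - have := cub (s / t); rewrite -(ler_pM2l t0) => H.
    have -> : h (s * x - t * y) (s * y + t * x) =
              t * h (s / t * x - y) (s / t * y + x).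
      by rewrite -hZ ?ltW//; congr h; field; rewrite gt_eqF.
    move: H; rewrite mulrBr (_ : t * (s / t * h x y) = s * h x y); first by lra.
    by field; rewrite gt_eqF.
  - have nt0 : 0 < - t by rewrite oppr_gt0.
    have := clb (s / - t); rewrite -(ler_pM2l nt0) => H.
    have -> : h (s * x - t * y) (s * y + t * x) =
              - t * h (s / - t * x + y) (s / - t * y - x).
      by rewrite -hZ ?ltW//; congr h; field; rewrite lt_eqF.
    move: H; rewrite mulrBr (_ : - t * (s / - t * h x y) = s * h x y); first by lra.
    by field; rewrite lt_eqF.
(* Coefficients of the functional with value [h x y] on [(x, y)] and [c] on [(- y, x)]; both vectors
   have squared length [r]. *)
exists ((x * h x y - y * c) / r), ((y * h x y + x * c) / r); split=> [u v|].
  have := key ((u * x + v * y) / r) ((v * x - u * y) / r).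
  have -> : (u * x + v * y) / r * x - (v * x - u * y) / r * y = u.
    by rewrite /r; field; rewrite gt_eqF.
  have -> : (u * x + v * y) / r * y + (v * x - u * y) / r * x = v.
    by rewrite /r; field; rewrite gt_eqF.
  apply: le_trans; rewrite le_eqVlt; apply/orP; left; apply/eqP.
  by field; rewrite gt_eqF.
by rewrite /r; field; rewrite gt_eqF.
Qed.

Lemma sublinear_support G p q : sublinear_lagrangian G ->
  exists a b : R, (forall q', a * q'.1 + b * q'.2 <= G p q') /\
                  a * q.1 + b * q.2 = G p q.
Proof.
move=> [_ GD GZ].
have hD x1 y1 x2 y2 : G p (x1 + x2, y1 + y2) <= G p (x1, y1) + G p (x2, y2).
  exact: (GD p (x1, y1) (x2, y2)).
have hZ l x y : 0 <= l -> G p (l * x, l * y) = l * G p (x, y).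
  exact: (GZ p (x, y)).
have H := sublinear_support_nz (fun x y => G p (x, y)) _ _ hD hZ.
case: q => x y /=.
have [r0|] := ltP 0 (x ^+ 2 + y ^+ 2).
  have [a [b [abG abE]]] := H _ _ r0.
  by exists a, b; split => // -[u v]; exact: abG.
move=> r0.
have /andP[/eqP x0 /eqP y0] : (x == 0) && (y == 0).
  rewrite -[x == 0]sqrf_eq0 -[y == 0]sqrf_eq0 -paddr_eq0 ?sqr_ge0//.
  by rewrite eq_le r0 addr_ge0 ?sqr_ge0.
(* At the origin every linear minorant of [G p] is exact; the one touching at [(1, 0)] is taken. *)
have [|a [b [abG _]]] := H 1 0; first by rewrite expr0n addr0 expr1n.
exists a, b; split; first by move=> -[u v]; exact: abG.
by have := hZ 0 0 0 (lexx 0); rewrite x0 y0 !mulr0 mul0r addr0 => ->.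
Qed.

(** * Estimates uniform over boxes *)

Definition box (B : R) : set (R * R) := `[- B, B]%classic `*` `[- B, B]%classic.

Lemma boxP B p : box B p <-> `|p.1| <= B /\ `|p.2| <= B.
Proof. by rewrite /box /= !in_itv/= -!ler_norml. Qed.

Lemma compact_box B : compact (box B).
Proof. by apply: compact_setX; exact: segment_compact. Qed.

(** A nonzero [q] is [l1norm q] times a point of the unit box, so a bound that scales with [q] need
    only be proved on that compact set. *)
Lemma box_scale (P : R * R -> R -> Prop) q :
  (forall l q c, 0 <= l -> P q c -> P (l * q.1, l * q.2) (l * c)) ->
  forall c, (forall q, box 1 q -> P q c) -> P q (l1norm q * c).
Proof.
move=> PZ c Pbox.
have [q0|qN0] := eqVneq (l1norm q) 0.
  rewrite q0 (l1norm_eq0 _ q0) mul0r.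
  have /Pbox/(PZ 0 _ _ (lexx 0)) : box 1 ((0, 0) : R * R).
    by apply/boxP; rewrite normr0.
  by rewrite /= !mul0r.
have q0 : 0 < l1norm q by rewrite lt_neqAle eq_sym qN0 l1norm_ge0.
have /(PZ _ _ _ (ltW q0)) : P (q.1 / l1norm q, q.2 / l1norm q) c.
  apply/Pbox/boxP; rewrite /= !normrM !normfV !(ger0_norm (ltW q0)).
  by rewrite !ler_pdivrMr// !mul1r /l1norm lerDl lerDr.
by rewrite /= ![l1norm q * (_ / _)]mulrC !divfK//; case: q {qN0 q0}.
Qed.

(** Compactness of the two boxes makes the modulus uniform, and homogeneity turns it into an error
    relative to [l1norm q]. *)
Lemma sublinear_unif_continuous G (B e : R) : sublinear_lagrangian G -> 0 < e ->
  exists2 d, 0 < d & forall p p' q, box B p ->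
    `|p.1 - p'.1| <= d -> `|p.2 - p'.2| <= d ->
    `|G p q - G p' q| <= l1norm q * e.
Proof.
move=> [Gc _ GZ] e0.
have /compact_near_coveringP cpt :=
  compact_setX (compact_box B) (compact_box 1).
pose P (d : R) (z : (R * R) * (R * R)) := forall p',
  `|z.1.1 - p'.1| <= d -> `|z.1.2 - p'.2| <= d -> `|G z.1 z.2 - G p' z.2| <= e.
have H : \forall d \near (0 : R)^'+, box B `*` box 1 `<=` P d.
  apply: cpt => -[p0 q0] _.
  have /cvgrPdist_lt/(_ (e / 2)) := Gc (p0, q0).
  rewrite divr_gt0// => /(_ isT) /nbhs_ballP[d /= d0 Hd].
  exists (ball (p0, q0) (d / 2), [set x | x < d / 2]) => /=.
    split; first by apply: nbhsx_ballx; rewrite divr_gt0.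
    by apply: nbhs_right_lt; rewrite divr_gt0.
  move=> [[p q] x] /= [[pb qb] xd] p' /= p1 p2.
  have d2 : d / 2 <= d by lra.
  have h1 : `|G p0 q0 - G p q| < e / 2.
    by apply: (Hd (p, q)); split; apply: le_ball d2 _ _.
  have h2 : `|G p0 q0 - G p' q| < e / 2.
    apply: (Hd (p', q)); split; last exact: le_ball d2 _ qb.
    case: pb => b1 b2; split; [move: b1|move: b2];
        rewrite -!ball_normE /ball_ /= => bd.
      rewrite (le_lt_trans (ler_distD p.1 _ _))// [ltRHS]splitr ltrD//.
      exact: le_lt_trans xd.
    rewrite (le_lt_trans (ler_distD p.2 _ _))// [ltRHS]splitr ltrD//.
    exact: le_lt_trans xd.
  rewrite (le_trans (ler_distD (G p0 q0) _ _))// [leRHS]splitr lerD// ltW//.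
  by rewrite distrC.
have [d [d0 Hd]] : exists d : R, 0 < d /\ box B `*` box 1 `<=` P d.
  near (0 : R)^'+ => d; exists d; split; first by [].
  by near: d.
exists d => // p p' q Bp p1 p2.
apply: (box_scale (fun q c => `|G p q - G p' q| <= c)) => [l q' c l0 h|q' bq'].
  by rewrite !GZ// -mulrBr normrM (ger0_norm l0) ler_wpM2l.
exact: (Hd (p, q')).
Unshelve. all: by end_near. Qed.

Lemma sublinear_bounded G (B : R) : sublinear_lagrangian G ->
  exists2 K, 0 <= K & forall p q, box B p -> `|G p q| <= K * l1norm q.
Proof.
move=> [Gc _ GZ].
have /compact_near_coveringP cpt :=
  compact_setX (compact_box B) (compact_box 1).
pose P (K : R) (z : (R * R) * (R * R)) := `|G z.1 z.2| <= K.
have H : \forall d \near +oo, box B `*` box 1 `<=` P d.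
  apply: cpt => -[p0 q0] _.
  have /cvgrPdist_lt/(_ 1 ltr01) near0 := Gc (p0, q0).
  exists ([set z | `|G p0 q0 - G z.1 z.2| < 1], [set x | `|G p0 q0| + 1 <= x]) => /=.
    by split => //; apply: nbhs_pinfty_ge; rewrite num_real.
  move=> [[p q] x] /= [h1 h2]; rewrite /P /=; apply: le_trans h2.
  have -> : G p q = G p0 q0 - (G p0 q0 - G p q) by ring.
  by rewrite (le_trans (ler_normB _ _))// lerD2l ltW.
have [K [K0 HK]] : exists K : R, 0 <= K /\ box B `*` box 1 `<=` P K.
  near (+oo : set_system R) => K; exists K; split; last by near: K.
  by near: K; apply: nbhs_pinfty_ge; rewrite num_real.
exists K => // p q Bp; rewrite mulrC.
apply: (box_scale (fun q c => `|G p q| <= c)) => [l q' c l0 h|q' bq'].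
  by rewrite !GZ// normrM (ger0_norm l0) ler_wpM2l.
exact: (HK (p, q')).
Unshelve. all: by end_near. Qed.

End sublinear.

(** * Measurability of compositions *)

Section measurability.
Context {R : realType} d (T : measurableType d).
Implicit Types (D : set T).

(** Rounding [f] down to multiples of 1/(n+1) leaves countably many values, on each of which the
    composition is some [phi x] with [x] fixed; continuity in the first argument gives the limit. *)
Lemma measurable_fun_caratheodory D (phi : R -> T -> R) (f : T -> R) :
  measurable D -> (forall x, measurable_fun D (phi x)) ->
  (forall t, continuous (phi ^~ t)) -> measurable_fun D f ->
  measurable_fun D (fun t => phi (f t) t).
Proof.
move=> mD mphi cphi mf.
pose r (n : nat) (x : R) : R := (Num.floor (x * n.+1%:R))%:~R / n.+1%:R.
apply: (@measurable_fun_cvg _ _ _ D (fun n t => phi (r n (f t)) t)) => [n|t Dt].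
  move=> _ Y mY.
  have -> : D `&` (fun t => phi (r n (f t)) t) @^-1` Y =
      \bigcup_(k : int) ((D `&` f @^-1` `[k%:~R / n.+1%:R, (k + 1)%:~R / n.+1%:R[)
        `&` (D `&` phi (k%:~R / n.+1%:R) @^-1` Y)).
    apply/seteqP; split=> [t [Dt Yt]|t [k _ [[_ kt] [Dt Yt]]]].
      exists (Num.floor (f t * n.+1%:R)) => //; split; last by split.
      split => //=; rewrite in_itv/= ler_pdivrMr// ltr_pdivlMr//.
      by rewrite real_floor_le ?real_floorD1_gt ?num_real.
    split => //; rewrite /= /r.
    suff -> : Num.floor (f t * n.+1%:R) = k by [].
    apply: floor_def; move: kt => /=.
    by rewrite in_itv/= ler_pdivrMr// ltr_pdivlMr.
  apply: countable_bigcupT_measurable => [|k]; first exact: countableP.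
  by apply: measurableI; [exact: mf|exact: mphi].
suff rl : r n (f t) @[n --> \oo] --> f t by exact: (cvg_comp _ _ rl (cphi t (f t))).
apply/cvgrPdist_lt => e e0; near=> n.
have n0 : 0 < n.+1%:R :> R by [].
have /andP[h1 h2] : (Num.floor (f t * n.+1%:R))%:~R <= f t * n.+1%:R <
   (Num.floor (f t * n.+1%:R) + 1)%:~R by exact: floor_itv.
have ne : n.+1%:R^-1 < e by near: n; exact: (near_infty_natSinv_lt (PosNum e0)).
have -> : f t - r n (f t) =
    (f t * n.+1%:R - (Num.floor (f t * n.+1%:R))%:~R) / n.+1%:R.
  by rewrite /r; field.
rewrite ger0_norm ?divr_ge0 ?subr_ge0//; apply: le_lt_trans ne.
rewrite ler_pdivrMr// mulVf// lerBlDl ltW//.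
by rewrite intrD1 in h2.
Unshelve. all: by end_near. Qed.

(** The four real coordinates are substituted one at a time, each application of the previous lemma
    turning a frozen argument into a measurable function. *)
Lemma measurable_fun_continuous4 D (G : R * R -> R * R -> R) (p q : T -> R * R) :
  continuous (fun z : (R * R) * (R * R) => G z.1 z.2) -> measurable D ->
  measurable_fun D (fun t => (p t).1) -> measurable_fun D (fun t => (p t).2) ->
  measurable_fun D (fun t => (q t).1) -> measurable_fun D (fun t => (q t).2) ->
  measurable_fun D (fun t => G (p t) (q t)).
Proof.
move=> Gc mD m1 m2 m3 m4.
have Gcomp (a b c e : R -> R) : continuous a -> continuous b -> continuous c ->
    continuous e -> continuous (fun x => G (a x, b x) (c x, e x)).
  move=> ca cb cc ce x.
  apply: (@continuous_comp _ _ _ (fun x => ((a x, b x), (c x, e x)))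
    (fun z : (R * R) * (R * R) => G z.1 z.2)); last exact: Gc.
  exact: (cvg_pair (cvg_pair (ca x) (cb x)) (cvg_pair (cc x) (ce x))).
have cid0 : continuous (@id R) by move=> x; exact: cvg_id.
have ccst (k : R) : continuous (fun _ : R => k) by move=> x; exact: cvg_cst.
have -> : (fun t => G (p t) (q t)) =
    (fun t => G ((p t).1, (p t).2) ((q t).1, (q t).2)).
  by apply/funext => t; case: (p t) (q t) => ? ? [].
apply: (measurable_fun_caratheodory _
  (fun x t => G (x, (p t).2) ((q t).1, (q t).2))) => // [x|t]; last exact: Gcomp.
apply: (measurable_fun_caratheodory _
  (fun y t => G (x, y) ((q t).1, (q t).2))) => // [y|t]; last exact: Gcomp.
apply: (measurable_fun_caratheodory _
  (fun z t => G (x, y) (z, (q t).2))) => // [z|t]; last exact: Gcomp.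
apply: (measurable_fun_caratheodory _
  (fun w t => G (x, y) (z, w))) => // t; exact: Gcomp.
Qed.

End measurability.

(** * Lipschitz functions are absolutely continuous *)

Section lipschitz_ftc.
Context {R : realType}.
Notation mu := (@lebesgue_measure R).
Implicit Types (f : R -> R).

Lemma Rintegral_cst_itv (a b K : R) : a <= b ->
  Rintegral mu `[a, b] (fun=> K) = K * (b - a).
Proof.
move=> ab; rewrite Rintegral_cst//; congr (_ * _).
have := lebesgue_measure_itv `[a, b]; rewrite /= lte_fin => ->.
have [//|ba] := ltP a b; have -> : a = b by apply/le_anti/andP.
by rewrite subrr.
Qed.

Lemma dist_le_continuous f (K : R) :
  (forall x y, `|f x - f y| <= K * `|x - y|) -> continuous f.
Proof.
move=> lipf x; apply/cvgrPdist_lt => e e0.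
have K0 : 0 < `|K| + 1 by rewrite ltr_wpDl.
have /cvgrPdist_lt/(_ (e / (`|K| + 1))) := @cvg_id _ (nbhs x).
rewrite divr_gt0// => /(_ isT); apply: filterS => y.
rewrite ltr_pdivlMr// mulrC; apply: le_lt_trans; rewrite (le_trans (lipf _ _))//.
by rewrite ler_wpM2r// (le_trans (ler_norm _))// lerDl.
Qed.

(** * Measurability of the derivative *)

Lemma derivable1_cvg f t :
  derivable f t 1 <-> cvg (h^-1 *: (f (h + t) - f t) @[h --> 0^']).
Proof.
rewrite /derivable.
suff -> : (fun h => h^-1 *: (f (h *: 1 + t) - f t)) =
          (fun h : R => h^-1 *: (f (h + t) - f t)) by [].
by apply/funext => h; rewrite [h *: 1]mulr1.
Qed.

Lemma measurable_derivable f : continuous f -> measurable [set t | derivable f t 1].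
Proof.
move=> cf.
pose q (h t : R) := h^-1 * (f (h + t) - f t).
(* Cauchy criterion for the difference quotients: as [f] is continuous, these sets
   are closed although [h] and [h'] range over uncountably many values. *)
pose E (k m : nat) := [set t | forall h h' : R, h != 0 -> h' != 0 ->
  `|h| < m.+1%:R^-1 -> `|h'| < m.+1%:R^-1 -> `|q h t - q h' t| <= k.+1%:R^-1].
have cq h : continuous (q h).
  move=> t; apply: cvgM; first exact: cvg_cst.
  apply: cvgB; last exact: cf.
  apply: (@continuous_comp _ _ _ (fun t => h + t) f); last exact: cf.
  by apply: cvgD; [exact: cvg_cst|exact: cvg_id].
have -> : [set t | derivable f t 1] = \bigcap_k \bigcup_m E k m.
  apply/seteqP; split => t /=.
    move=> /derivable1_cvg /cvg_ex[l ql] k _.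
    have /cvgrPdist_le/(_ (k.+1%:R^-1 / 2)) := ql.
    rewrite divr_gt0 ?invr_gt0// => /(_ isT).
    rewrite near_withinE => -[e /= e0 He].
    have [m _ mP] := near_infty_natSinv_lt (PosNum e0).
    exists m => // h h' h0 h'0 hm h'm.
    have Hq u : u != 0 -> `|u| < m.+1%:R^-1 -> `|l - q u t| <= k.+1%:R^-1 / 2.
      move=> u0 um; apply: He => //=.
      by rewrite sub0r normrN (lt_trans um)// mP//=.
    have -> : q h t - q h' t = (l - q h' t) - (l - q h t) by ring.
    rewrite (le_trans (ler_normB _ _))// [leRHS]splitr.
    by rewrite lerD// Hq.
  move=> Et; apply/derivable1_cvg/cauchy_cvgP/cauchy_ballP => e e0.
  have [k _ kP] := near_infty_natSinv_lt (PosNum e0).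
  have [m _ Em] := Et k I.
  have key : \forall h \near (0 : R)^', h != 0 /\ `|h| < m.+1%:R^-1.
    near=> h; split; near: h; first exact: nbhs_dnbhs_neq.
    by apply: dnbhs0_lt; rewrite invr_gt0.
  exists ([set q h t | h in [set h | h != 0 /\ `|h| < m.+1%:R^-1]],
          [set q h t | h in [set h | h != 0 /\ `|h| < m.+1%:R^-1]]) => /=.
    by split; apply: filterS key => h hh; exists h.
  move=> [_ _] [/= [h [h0 hm] <-] [h' [h'0 h'm] <-]].
  rewrite -ball_normE /ball_ /=.
  by apply: le_lt_trans (kP k (leqnn k)); apply: Em.
apply: bigcapT_measurable => k; apply: bigcupT_measurable => m.
apply: closed_measurable.
have -> : E k m = \bigcap_(hh in [set hh : R * R | [/\ hh.1 != 0, hh.2 != 0,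
    `|hh.1| < m.+1%:R^-1 & `|hh.2| < m.+1%:R^-1]])
   [set t | `|q hh.1 t - q hh.2 t| <= k.+1%:R^-1].
  apply/seteqP; split => t /=.
    by move=> Et [h h'] /= [? ? ? ?]; exact: Et.
  by move=> Et h h' ? ? ? ?; apply: (Et (h, h')).
apply: closed_bigI => -[h h'] /= _.
apply: (@closed_comp _ _ (fun t => `|q h t - q h' t|) [set x | x <= k.+1%:R^-1]).
  by move=> t _; apply: cvg_norm; apply: cvgB; exact: cq.
exact: closed_le.
Unshelve. all: by end_near. Qed.

(** [derive1] is total: where the difference quotients have no limit it takes the default value [c],
    the same at all such points. On the measurable set of differentiability it is the limit of the
    quotients with steps 1/(n+1). *)
Lemma measurable_derive1 f : continuous f -> measurable_fun setT (derive1 f).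
Proof.
move=> cf.
pose q (n : nat) (t : R) := n.+1%:R * (f (n.+1%:R^-1 + t) - f t).
pose c : R := get [set l | False].
have fE t : ~ derivable f t 1 -> derive1 f t = c.
  move=> /derivable1_cvg Nc; rewrite /derive1 /c /lim /lim_in; congr get.
  apply/seteqP; split => l //= cl; apply: Nc; apply/cvg_ex; exists l; exact: cl.
set D := [set t | derivable f t 1].
have mD : measurable D := measurable_derivable _ cf.
rewrite -(setUv D); apply/measurable_funU => //; first exact: measurableC.
split.
- apply: (@measurable_fun_cvg _ _ _ D q) => [n|t Dt].
    apply: measurable_funTS; apply: continuous_measurable_fun => t.
    apply: cvgM; first exact: cvg_cst.
    apply: cvgB; last exact: cf.
    apply: (@continuous_comp _ _ _ (fun t => _ + t) f); last exact: cf.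
    by apply: cvgD; [exact: cvg_cst|exact: cvg_id].
  have /derivable1_cvg dt : derivable f t 1 by exact: Dt.
  have := cvgP _ dt.
  rewrite /derive1.
  move: dt; set g := (fun h : R => _) => dt.
  have -> : q ^~ t = g \o (fun n => n.+1%:R^-1).
    by apply/funext => n /=; rewrite /q /g /= invrK.
  move=> gt; apply: ((cvgr_dnbhsP _ _ _).1 gt); split => [n|].
    by rewrite invr_eq0 pnatr_eq0.
  exact: cvg_harmonic.
- apply: (eq_measurable_fun (cst c)); last exact: measurable_cst.
  by move=> t; rewrite inE => /fE ->.
Qed.

(** * Lipschitz functions and Stieltjes measures *)

Lemma lebesgue_stieltjes_itv (g : cumulative R R) (a b : R) : a <= b ->
  lebesgue_stieltjes_measure g `]a, b]%classic = ((g b)%:E - (g a)%:E)%E.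
Proof.
move=> ab; rewrite /lebesgue_stieltjes_measure /measure_extension.
by rewrite measurable_mu_extE/=; [rewrite wlength_itv_bnd|exact: is_ocitv].
Qed.

(* The Stieltjes measures of [K x + f] and [K x - f] add up to [2 K] times the
   Lebesgue measure, hence each of them is absolutely continuous. *)
Lemma lipschitz_density f (K a b : R) : 0 < K ->
  (forall x y, `|f x - f y| <= K * `|x - y|) -> a <= b ->
  exists r : R -> R, mu.-integrable setT (EFin \o r) /\
    forall x, a <= x <= b ->
      K * (x - a) + (f x - f a) = Rintegral mu `]a, x] r.
Proof.
move=> K0 lipf ab.
have cf := dist_le_continuous _ _ lipf.
have mkcum (g : R -> R) : {homo g : x y / x <= y} -> continuous g ->
    exists h : cumulative R R, h =1 g.
  move=> gnd gc.
  pose h : cumulative R R := HB.pack g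
    (isCumulative.Build R _ R g gnd (right_continuousW gc)).
  by exists h.
have lipf' x y : x <= y -> `|f y - f x| <= K * (y - x).
  by move=> xy; rewrite (le_trans (lipf _ _))// ger0_norm// subr_ge0.
have [g1 g1E] : exists h : cumulative R R, h =1 (fun x => K * x + f x).
  apply: mkcum => [x y xy|x].
    have := lipf' _ _ xy; rewrite ler_norml => /andP[h _].
    by rewrite -subr_ge0; lra.
  by apply: cvgD; [apply: cvgM; [exact: cvg_cst|exact: cvg_id]|exact: cf].
have [g2 g2E] : exists h : cumulative R R, h =1 (fun x => K * x - f x).
  apply: mkcum => [x y xy|x].
    have := lipf' _ _ xy; rewrite ler_norml => /andP[_ h].
    by rewrite -subr_ge0; lra.
  by apply: cvgB; [apply: cvgM; [exact: cvg_cst|exact: cvg_id]|exact: cf].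
pose m1 := lebesgue_stieltjes_measure g1.
pose m2 := lebesgue_stieltjes_measure g2.
have K2 : 0 <= (2 * K)^-1 by rewrite invr_ge0 mulr_ge0// ltW.
pose m := mscale (NngNum K2) (measure_add m1 m2).
have maddE X : m X = (((2 * K)^-1)%:E * (m1 X + m2 X))%E.
  by congr (_ * _)%E; exact: measure_addE.
have mE A : measurable A -> mu A = m A.
  apply: lebesgue_measure_unique => X /ocitvP[->|[[x y] /= xy ->]].
    by rewrite !measure0.
  transitivity (m `]x, y]%classic); last by [].
  rewrite maddE /m1 /m2 !lebesgue_stieltjes_itv ?(ltW xy)//.
  rewrite /lebesgue_measure lebesgue_stieltjes_itv ?(ltW xy)//= !g1E !g2E.
  rewrite -!EFinB -EFinD -EFinM; congr EFin.
  by field; rewrite gt_eqF.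
have m1mu : m1 `<< mu.
  apply/null_content_dominatesP => A mA muA0.
  have /eqP := etrans (esym (mE A mA)) muA0.
  rewrite maddE mule_eq0 eqe invr_eq0 mulf_eq0 pnatr_eq0/= (gt_eqF K0)/=.
  by rewrite padde_eq0// => /andP[/eqP].
have mI : measurable (`]a, b]%classic : set (measurableTypeR R)) by exact: measurable_itv.
have m1fin : (m1 `]a, b]%classic < +oo)%E.
  by rewrite /m1 lebesgue_stieltjes_itv// -EFinB ltry.
(* Radon-Nikodym is applied to a finite measure, hence the restriction to []a, b]] and a formula for
   [x] in [[a, b]] only. *)
pose m1r : {finite_measure set (measurableTypeR R) -> \bar R} := mfrestr mI m1fin.
pose nu := charge_of_finite_measure m1r.
have numu : nu `<< mu.
  apply/null_content_dominatesP => A mA muA0.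
  rewrite /nu /charge_of_finite_measure /m1r /= /mfrestr /mrestr /=.
  apply: (subset_measure0 (B := A)) => //; first exact: measurableI.
  by move/null_content_dominatesP : m1mu; apply.
have irn := Radon_Nikodym_integrable numu.
have frn x := Radon_Nikodym_fin_num x numu.
exists (fun x => fine (Radon_Nikodym nu mu x)); split.
  apply: eq_integrable irn => // x _ /=; by rewrite fineK.
move=> x /andP[ax xb].
have mx : measurable `]a, x]%classic by [].
have := Radon_Nikodym_integral numu mx.
rewrite /Rintegral; under [in X in _ -> _ = fine X]eq_integral do rewrite fineK//.
move=> <-; rewrite /nu /charge_of_finite_measure /m1r /= /mfrestr /mrestr /=.
rewrite setIidl; last by apply: subset_itvl; rewrite bnd_simp.
rewrite /m1 lebesgue_stieltjes_itv// !g1E /=.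
by ring.
Unshelve. all: by end_near. Qed.

(** By Lebesgue differentiation, the primitive of the density [r] of [K x + f] has derivative [r]
    almost everywhere; subtracting [K] gives the derivative of [f]. *)
Lemma lipschitz_derivative f (K a b : R) :
  (forall x y, `|f x - f y| <= K * `|x - y|) -> a <= b ->
  exists h : R -> R, [/\ mu.-integrable `[a, b] (EFin \o h),
    f b - f a = Rintegral mu `[a, b] h &
    {ae mu, forall x, a <= x <= b ->
      h0^-1 *: (f (h0 + x) - f x) @[h0 --> 0^'] --> h x}].
Proof.
wlog K0 : K / 0 < K.
  move=> H lipf; apply: (H (`|K| + 1)) => [|x y]; first by rewrite ltr_wpDl.
  rewrite (le_trans (lipf x y))// ler_wpM2r// (le_trans (ler_norm _))//.
  by rewrite lerDl.
move=> lipf ab.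
have [r [ir rE]] := lipschitz_density _ _ _ _ K0 lipf ab.
have lr : locally_integrable setT r.
  split; first by apply/measurable_EFinP; exact: (measurable_int mu).
    exact: openT.
  move=> k _ ck.
  have : mu.-integrable k (EFin \o r).
    apply: integrableS ir => //; exact: compact_measurable.
  by move=> /integrableP[].
have iry y : mu.-integrable [set` Interval (BRight a) (BRight y)] (EFin \o r).
  exact: integrableS ir.
have /= ftc := FTC1 iry lr.
pose h x := r x - K.
have icst (c : R) : mu.-integrable `[a, b] (EFin \o cst c).
  apply: continuous_compact_integrable; first exact: segment_compact.
  by apply: continuous_subspaceT => x; exact: cvg_cst.
have ih : mu.-integrable `[a, b] (EFin \o h).
  have -> : EFin \o h = ((EFin \o r) \- (EFin \o cst K))%E.
    by apply/funext => x /=; rewrite EFinB.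
  by apply: integrableB => //; exact: integrableS ir.
have dfh x : a < x -> derivable (fun y => Rintegral mu `]a, y] r) x 1 /\
    derive1 (fun y => Rintegral mu `]a, y] r) x = r x ->
    x < b -> h0^-1 *: (f (h0 + x) - f x) @[h0 --> 0^'] --> h x.
  move=> ax [dF FE] xb.
  pose F1 y := Rintegral mu `]a, y] r.
  have cF : h0^-1 *: (F1 (h0 + x) - F1 x) @[h0 --> 0^'] --> r x.
    by rewrite -FE; apply/derivable1_cvg.
  have cFK : h0^-1 *: (F1 (h0 + x) - F1 x) - K @[h0 --> 0^'] --> r x - K.
    by apply: cvgB => //; exact: cvg_cst.
  apply: cvg_trans cFK; apply: near_eq_cvg; near=> h0.
  have h00 : h0 != 0 by near: h0; exact: nbhs_dnbhs_neq.
  have h0x : `|h0| < Num.min (x - a) (b - x).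
    by near: h0; apply: dnbhs0_lt; rewrite lt_min !subr_gt0 ax.
  have /andP[/ltr_normlP[h1 h2] /ltr_normlP[h3 h4]] : (`|h0| < x - a) && (`|h0| < b - x).
    by move: h0x; rewrite lt_min.
  have e1 : a <= h0 + x <= b by apply/andP; split; lra.
  have e2 : a <= x <= b by rewrite !ltW.
  rewrite /F1 -(rE _ e1) -(rE _ e2) /GRing.scale/=.
  by field.
exists h; split => //.
  have irab : mu.-integrable `[a, b] (EFin \o r) by exact: integrableS ir.
  rewrite /h RintegralB//; last exact: icst.
  rewrite Rintegral_cst_itv//.
  have := rE b; rewrite ab lexx => /(_ isT).
  by rewrite Rintegral_itv_obnd_cbnd//; move=> <-; ring.
have nab : {ae mu, forall x, x != a /\ x != b}.
  exists ([set a] `|` [set b]); split.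
  - exact: measurableU.
  - by apply: null_set_setU => //; exact: lebesgue_measure_set1.
  - move=> x /= /not_andP[/negP|/negP]; rewrite negbK => /eqP ->; by [left|right].
have Fmu := ae_filter_ringOfSetsType mu.
apply: (filterS2 _ _ ftc nab) => x Hx [xa xb] /andP[ax bx].
have ax' : a < x by rewrite lt_neqAle eq_sym xa.
have bx' : x < b by rewrite lt_neqAle xb.
by apply: dfh => //; apply: Hx; rewrite lte_fin.
Unshelve. all: by end_near. Qed.

Lemma lipschitz_ae_derivable f (K a b : R) :
  (forall x y, `|f x - f y| <= K * `|x - y|) -> a <= b ->
  {ae mu, forall x, a <= x <= b -> derivable f x 1}.
Proof.
move=> lipf ab; have [h [_ _ fh]] := lipschitz_derivative f K a b lipf ab.
have Fmu := ae_filter_ringOfSetsType mu.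
apply: filterS fh => x fx xab.
by apply/derivable1_cvg/cvg_ex; exists (h x); exact: fx.
Qed.

(** [derive1 f] is measurable and agrees almost everywhere with the integrable [h] of
    [lipschitz_derivative], so it inherits integrability and the integral formula. *)
Lemma lipschitz_W11loc f (K : R) :
  (forall x y, `|f x - f y| <= K * `|x - y|) -> W11loc_R f.
Proof.
move=> lipf a b ab.
have cf := dist_le_continuous _ _ lipf.
have mdf := measurable_derive1 _ cf.
have [h [ih -> fh]] := lipschitz_derivative f K a b lipf ab.
have Fmu := ae_filter_ringOfSetsType mu.
have aeE : ae_eq mu `[a, b]%classic (EFin \o derive1 f) (EFin \o h).
  apply: filterS fh => x fx; rewrite /= in_itv/= => xab.
  by congr EFin; apply/cvg_lim => //; exact: fx.
have mh := measurable_int mu ih.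
have mdf' : measurable_fun `[a, b] (EFin \o derive1 f).
  by apply/measurable_EFinP; apply: measurable_funTS.
split.
  apply/integrableP; split => //.
  have /integrableP[_ hfin] := ih.
  apply: le_lt_trans hfin; rewrite le_eqVlt; apply/orP; left; apply/eqP.
  apply: ae_eq_integral => //.
  - exact: measurableT_comp.
  - exact: measurableT_comp.
  - by apply: filterS aeE => x /= fxh /fxh [->].
by congr fine; apply/esym; apply: ae_eq_integral.
Qed.

End lipschitz_ftc.

(** * Curves of class W^{1,1} and Jensen sums *)

Section W11_curves.
Context {R : realType}.
Notation mu := (@lebesgue_measure R).
Implicit Types (f : R -> R) (u v : R -> R * R) (G : R * R -> R * R -> R).

Lemma Rintegral_chasles f (a c b : R) : a <= c -> c <= b ->
  mu.-integrable `[a, b] (EFin \o f) ->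
  Rintegral mu `[a, b] f = Rintegral mu `[a, c] f + Rintegral mu `[c, b] f.
Proof.
move=> ac cb intf.
have := Rintegral_itvB (a := BLeft a) (b := BRight b) (x := c) intf.
rewrite !bnd_simp => /(_ ac cb) E.
rewrite -[X in _ = _ + X]Rintegral_itv_obnd_cbnd; first by rewrite -E subrKC.
by apply: integrableS intf => //; apply: subset_itv; rewrite bnd_simp.
Qed.

Lemma integrable_sub f (a b c d : R) : a <= c -> d <= b ->
  mu.-integrable `[a, b] (EFin \o f) -> mu.-integrable `[c, d] (EFin \o f).
Proof.
by move=> ac db; apply: integrableS => //; apply: subset_itv; rewrite bnd_simp.
Qed.

Lemma W11loc_integrable f (a b : R) : W11loc_R f ->
  mu.-integrable `[a, b] (EFin \o derive1 f).
Proof.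
move=> Wf; have [ab|ba] := leP a b; first by have [] := Wf _ _ ab.
by rewrite set_itv_ge ?bnd_simp ?leNgt ?negbK//; exact: integrable_set0.
Qed.

Lemma W11loc_continuous f : W11loc_R f -> continuous f.
Proof.
move=> Wf t.
have tt : t - 1 <= t + 1 by lra.
have := parameterized_integral_continuous tt (W11loc_integrable f _ _ Wf).
have tt' : t - 1 < t + 1 by lra.
move=> /(continuous_within_itvP _ tt')[/(_ t) H _ _].
have /H {}H : t \in `]t - 1, t + 1[ by rewrite in_itv/=; apply/andP; split; lra.
have fE s : t - 1 <= s -> f (t - 1) + Rintegral mu `[t - 1, s] (derive1 f) = f s.
  by move=> ts; rewrite -(Wf _ _ ts).2 subrKC.
have {}H : f (t - 1) + Rintegral mu `[t - 1, s] (derive1 f) @[s --> t] --> f t.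
  by rewrite -[X in _ --> X]fE; [apply: cvgD; [exact: cvg_cst|exact: H]|lra].
apply: cvg_trans H; apply: near_eq_cvg; near=> s.
rewrite fE// ltW//; near: s; apply: lt_nbhsr; lra.
Unshelve. all: by end_near. Qed.

Lemma dist_W11loc f (a b : R) : W11loc_R f -> a <= b ->
  `|f b - f a| <= Rintegral mu `[a, b] (fun t => `|derive1 f t|).
Proof.
move=> Wf ab; have [intf ->] := Wf _ _ ab.
exact: le_normr_Rintegral.
Qed.

Lemma integrable_norm_derive1 f (a b : R) : W11loc_R f ->
  mu.-integrable `[a, b] (EFin \o (fun t => `|derive1 f t|)).
Proof.
move=> Wf; exact: (integrable_norm (W11loc_integrable f a b Wf)).
Qed.

Section curve.
Variable u : R -> R * R.
Hypotheses (W1 : W11loc_R (fun s => (u s).1)) (W2 : W11loc_R (fun s => (u s).2)).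

Lemma W11_box (a b : R) : exists2 B, 0 <= B & forall t, a <= t <= b -> box B (u t).
Proof.
have bnd f : W11loc_R f -> exists2 B, 0 <= B & forall t, a <= t <= b -> `|f t| <= B.
  move=> Wf.
  have /compact_bounded[M [_ HM]] : compact (f @` `[a, b]).
    apply: continuous_compact; last exact: segment_compact.
    apply: continuous_subspaceT => x; exact: (W11loc_continuous f Wf x).
  exists (`|M| + 1) => [|t tab]; first by rewrite addr_ge0.
  apply: (HM (`|M| + 1)); first by rewrite (le_lt_trans (ler_norm _))// ltrDl.
  by exists t => //; rewrite /= in_itv.
have [B1 B10 H1] := bnd _ W1; have [B2 B20 H2] := bnd _ W2.
exists (B1 + B2) => [|t tab]; first by rewrite addr_ge0.
apply/boxP; rewrite (le_trans (H1 _ tab)) ?lerDl//.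
by rewrite (le_trans (H2 _ tab)) ?lerDr.
Qed.

Lemma integrable_l1_vel (a b : R) :
  mu.-integrable `[a, b] (EFin \o (fun t => l1norm (vel u t))).
Proof.
have -> : EFin \o (fun t => l1norm (vel u t)) =
  ((EFin \o (fun t => `|derive1 (fun s => (u s).1) t|)%R) \+
   (EFin \o (fun t => `|derive1 (fun s => (u s).2) t|)%R))%E.
  by apply/funext => t /=; rewrite -EFinD.
apply: integrableD; first exact: measurable_itv.
  exact: (integrable_norm_derive1 _ a b W1).
exact: (integrable_norm_derive1 _ a b W2).
Qed.

Lemma measurable_energy G (c : R -> R * R) (a b : R) : sublinear_lagrangian G ->
  continuous (fun t => (c t).1) -> continuous (fun t => (c t).2) ->
  measurable_fun `[a, b] (fun t => G (c t) (vel u t)).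
Proof.
move=> [Gc _ _] c1 c2; apply: measurable_fun_continuous4 => //.
- by apply: measurable_funTS; exact: continuous_measurable_fun.
- by apply: measurable_funTS; exact: continuous_measurable_fun.
- apply/measurable_EFinP; apply: (measurable_int mu).
  exact: (W11loc_integrable _ a b W1).
- apply/measurable_EFinP; apply: (measurable_int mu).
  exact: (W11loc_integrable _ a b W2).
Qed.

Lemma integrable_energy_along G (c : R -> R * R) (a b B : R) :
  sublinear_lagrangian G ->
  continuous (fun t => (c t).1) -> continuous (fun t => (c t).2) ->
  (forall t, a <= t <= b -> box B (c t)) ->
  mu.-integrable `[a, b] (EFin \o (fun t => G (c t) (vel u t))).
Proof.
move=> GL c1 c2 cB; have [K K0 HK] := sublinear_bounded G B GL.
have mG := measurable_energy G c a b GL c1 c2.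
have iK : mu.-integrable `[a, b] (EFin \o (fun t => K * l1norm (vel u t))).
  have := integrableZl _ K (integrable_l1_vel a b).
  have -> : (fun x => K%:E * (EFin \o (fun t => l1norm (vel u t))) x)%E =
            (EFin \o (fun t => K * l1norm (vel u t))).
    by apply/funext => t /=; rewrite EFinM.
  exact.
apply: le_integrable iK => //; first exact/measurable_EFinP.
move=> t; rewrite /= in_itv/= => tab; rewrite lee_fin.
by rewrite (le_trans (HK _ _ (cB _ tab)))// ler_norm.
Qed.

Lemma integrable_energy G (a b : R) : sublinear_lagrangian G ->
  mu.-integrable `[a, b] (EFin \o (fun t => G (u t) (vel u t))).
Proof.
move=> GL; have [B _ HB] := W11_box a b.
exact: (integrable_energy_along G u a b B GL
  (W11loc_continuous _ W1) (W11loc_continuous _ W2) HB).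
Qed.

(** A linear minorant of [G p] touching it at the increment commutes with the integral of the
    velocity. By one-homogeneity the increment itself appears, not an average. *)
Lemma jensen_sublinear G (p : R * R) (a b : R) : sublinear_lagrangian G -> a <= b ->
  G p ((u b).1 - (u a).1, (u b).2 - (u a).2) <=
    Rintegral mu `[a, b] (fun t => G p (vel u t)).
Proof.
move=> GL ab.
have [x [y [xyG <-]]] := sublinear_support G p
  ((u b).1 - (u a).1, (u b).2 - (u a).2) GL.
have [i1 /= ->] := W1 a b ab; have [i2 /= ->] := W2 a b ab.
have iZ (z : R) f : mu.-integrable `[a, b] (EFin \o f) ->
    mu.-integrable `[a, b] (EFin \o (fun t => z * f t)).
  move=> intf; have := integrableZl _ z intf.
  have -> : (fun x => z%:E * (EFin \o f) x)%E = (EFin \o (fun t => z * f t)).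
    by apply/funext => t /=; rewrite EFinM.
  exact.
rewrite -!RintegralZl// -RintegralD//; [|exact: iZ|exact: iZ].
have iG : mu.-integrable `[a, b] (EFin \o (fun t => G p (vel u t))).
  apply: (integrable_energy_along G (fun=> p) _ _ (`|p.1| + `|p.2|)) => //.
  - by move=> ?; exact: cvg_cst.
  - by move=> ?; exact: cvg_cst.
  - by move=> t _; apply/boxP; rewrite lerDl lerDr.
apply: le_Rintegral => //.
  have -> : (EFin \o (fun t => x * derive1 (fun s => (u s).1) t +
                               y * derive1 (fun s => (u s).2) t)) =
     ((EFin \o (fun t => x * derive1 (fun s => (u s).1) t)%R) \+
      (EFin \o (fun t => y * derive1 (fun s => (u s).2) t)%R))%E.
    by apply/funext => t /=; rewrite EFinD.
  by apply: integrableD => //; exact: iZ.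
by move=> t _; exact: (xyG (vel u t)).
Qed.

Definition increment_energy G u (s t : R) :=
  G (u s) ((u t).1 - (u s).1, (u t).2 - (u s).2).

(** Jensen applies with the base point frozen at [u a]; releasing it to [u t] costs at most
    [e * l1norm (vel u t)], since the curve stays within [d] of [u a]. *)
Lemma increment_energy_le G (a b B d e : R) : sublinear_lagrangian G -> a <= b ->
  (forall p p' q, box B p -> `|p.1 - p'.1| <= d -> `|p.2 - p'.2| <= d ->
    `|G p q - G p' q| <= l1norm q * e) ->
  box B (u a) ->
  (forall t, a <= t <= b -> `|(u a).1 - (u t).1| <= d /\ `|(u a).2 - (u t).2| <= d) ->
  increment_energy G u a b <=
    Rintegral mu `[a, b] (fun t => G (u t) (vel u t) + e * l1norm (vel u t)).
Proof.
move=> GL ab Gmod Ba osc.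
apply: le_trans (jensen_sublinear G (u a) a b GL ab) _.
have il1 := integrable_l1_vel a b.
have iG := integrable_energy G a b GL.
apply: le_Rintegral => //.
- apply: (integrable_energy_along G (fun=> u a) _ _ B) => //.
  + by move=> ?; exact: cvg_cst.
  + by move=> ?; exact: cvg_cst.
- have -> : (EFin \o (fun t => G (u t) (vel u t) + e * l1norm (vel u t))) =
     ((EFin \o (fun t => G (u t) (vel u t))) \+
      (fun t => e%:E * (EFin \o (fun t => l1norm (vel u t))) t))%E.
    by apply/funext => t /=; rewrite EFinD EFinM.
  by apply: integrableD => //; exact: integrableZl.
- move=> t; rewrite /= in_itv/= => tab.
  have [le1 le2] := osc t tab.
  move: (Gmod (u a) (u t) (vel u t) Ba le1 le2).
  by rewrite ler_norml => /andP[_]; rewrite lerBlDl [l1norm _ * _]mulrC.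
Qed.

(** The nodes form an arbitrary nondecreasing sequence, because they will be the images of a uniform
    grid under a reparametrization. *)
Lemma increment_energy_sum_le G (t : nat -> R) (N : nat) (B d e : R) :
  sublinear_lagrangian G ->
  (forall i, (i < N)%N -> t i <= t i.+1) ->
  (forall p p' q, box B p -> `|p.1 - p'.1| <= d -> `|p.2 - p'.2| <= d ->
    `|G p q - G p' q| <= l1norm q * e) ->
  (forall i, (i < N)%N -> box B (u (t i))) ->
  (forall i s, (i < N)%N -> t i <= s <= t i.+1 ->
    `|(u (t i)).1 - (u s).1| <= d /\ `|(u (t i)).2 - (u s).2| <= d) ->
  \sum_(i < N) increment_energy G u (t i) (t i.+1) <=
    Rintegral mu `[t 0%N, t N] (fun t => G (u t) (vel u t)) +
    e * Rintegral mu `[t 0%N, t N] (fun t => l1norm (vel u t)).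
Proof.
move=> GL + Gmod; elim: N => [|N IH] tnd tB osc.
  by rewrite big_ord0 set_itv1 !Rintegral_set1 mulr0 addr0.
rewrite big_ord_recr/=.
have t0N : t 0%N <= t N.
  have : forall n, (n <= N)%N -> t 0%N <= t n.
    elim=> [//|n IHn] nN; apply: (le_trans (IHn (ltnW nN))).
    by apply: tnd; exact: ltnW.
  exact.
have tNN := tnd N (ltnSn N).
have iG := integrable_energy G (t 0%N) (t N.+1) GL.
have il := integrable_l1_vel (t 0%N) (t N.+1).
rewrite (Rintegral_chasles _ _ _ _ t0N tNN iG).
rewrite (Rintegral_chasles _ _ _ _ t0N tNN il).
rewrite mulrDr addrACA lerD//.
  apply: IH => [i iN|i iN|i s iN]; [exact/tnd/ltnW|exact/tB/ltnW|].
  exact/osc/ltnW.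
apply: le_trans (increment_energy_le G _ _ B d e GL tNN Gmod _ _) _.
- exact: tB.
- by move=> s; exact: osc.
have iG' := integrable_energy G (t N) (t N.+1) GL.
have il' := integrable_l1_vel (t N) (t N.+1).
rewrite RintegralD//; first by rewrite RintegralZl.
have -> : (EFin \o (fun t => e * l1norm (vel u t))) =
      (fun t => e%:E * (EFin \o (fun t => l1norm (vel u t))) t)%E.
  by apply/funext => s /=; rewrite EFinM.
exact: integrableZl.
Qed.

End curve.
End W11_curves.

(** * Convergence of the sums along Lipschitz curves *)

Section discrete_energy.
Context {R : realType}.
Notation mu := (@lebesgue_measure R).
Implicit Types (f : R -> R) (v : R -> R * R) (G : R * R -> R * R -> R).

Definition grid (n i : nat) : R := i%:R / n.+1%:R.

Definition round_down (n : nat) (x : R) : R := (Num.floor (x * n.+1%:R))%:~R / n.+1%:R.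

Lemma round_down_itv n x :
  round_down n x <= x < round_down n x + n.+1%:R^-1.
Proof.
have n0 : 0 < n.+1%:R :> R by [].
rewrite /round_down ler_pdivrMr// -[X in _ + X]mul1r -mulrDl ltr_pdivlMr//.
by rewrite -intrD1; exact: floor_itv.
Qed.

Lemma round_down_grid n i x : grid n i <= x < grid n i.+1 ->
  round_down n x = grid n i.
Proof.
have n0 : 0 < n.+1%:R :> R by [].
rewrite /grid ler_pdivrMr// ltr_pdivlMr// => H; rewrite /round_down.
suff -> : Num.floor (x * n.+1%:R) = i%:Z by [].
by apply: floor_def; rewrite intrD1 -pmulrn natr1.
Qed.

(** The slope over the mesh cell containing [x], that is, the derivative of the piecewise affine
    interpolation of [f]. *)
Definition difference_quotient f n (x : R) :=
  n.+1%:R * (f (round_down n x + n.+1%:R^-1) - f (round_down n x)).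

Lemma cvg_round_down x : round_down n x @[n --> \oo] --> x.
Proof.
apply/cvgrPdist_lt => e e0; near=> n.
have /andP[h1 h2] := round_down_itv n x.
rewrite ger0_norm ?subr_ge0//.
apply: (lt_trans (y := n.+1%:R^-1)); first by rewrite ltrBlDl.
by near: n; exact: (near_infty_natSinv_lt (PosNum e0)).
Unshelve. all: by end_near. Qed.

(* Straddle lemma: the mesh cell containing [x] need not start at [x]. *)
Lemma cvg_difference_quotient f x : derivable f x 1 ->
  difference_quotient f n x @[n --> \oo] --> derive1 f x.
Proof.
move=> /derivable1_cvg df.
have {}df := cvgP _ df : h^-1 *: (f (h + x) - f x) @[h --> 0^'] --> derive1 f x.
set l := derive1 f x in df *.
apply/cvgrPdist_le => e e0.
move/cvgrPdist_le : df => /(_ e e0); rewrite near_withinE => -[d /= d0 Hd].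
(* Clearing the denominator admits [h = 0], which occurs when [x] is itself a node. *)
have key h : `|h| < d -> `|f (h + x) - f x - l * h| <= e * `|h|.
  move=> hd; have [->|h0] := eqVneq h 0.
    by rewrite add0r subrr mulr0 subr0 normr0 mulr0.
  have := Hd h; rewrite /= sub0r normrN => /(_ hd h0) H.
  have -> : f (h + x) - f x - l * h = - (l - h^-1 *: (f (h + x) - f x)) * h.
    by rewrite /GRing.scale/=; field.
  by rewrite normrM normrN ler_wpM2r.
near=> n.
have n0 : 0 < n.+1%:R :> R by [].
have ne : n.+1%:R^-1 < d by near: n; exact: (near_infty_natSinv_lt (PosNum d0)).
have /andP[h1 h2] := round_down_itv n x.
rewrite /difference_quotient; set a := round_down n x in h1 h2 *.
set w := n.+1%:R^-1 in ne h2 *.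
have w0 : 0 < w by rewrite invr_gt0.
have k1 := key (a - x); have k2 := key (a + w - x).
rewrite !subrK in k1 k2.
have E1 : `|a - x| = x - a by rewrite ler0_norm ?opprB// subr_le0.
have E2 : `|a + w - x| = a + w - x by rewrite ger0_norm// subr_ge0 ltW.
have {}k1 : `|f a - f x - l * (a - x)| <= e * (x - a).
  by rewrite -E1; apply: k1; rewrite E1 (lt_trans _ ne)// ltrBlDl.
have {}k2 : `|f (a + w) - f x - l * (a + w - x)| <= e * (a + w - x).
  rewrite -[X in e * X]E2; apply: k2; rewrite E2 (le_lt_trans _ ne)//.
  by rewrite lerBlDl lerD2r.
have -> : l - n.+1%:R * (f (a + w) - f a) =
   ((f a - f x - l * (a - x)) - (f (a + w) - f x - l * (a + w - x))) / w.
  by rewrite /w invrK; field.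
rewrite normrM normfV (gtr0_norm w0) ler_pdivrMr//.
rewrite (le_trans (ler_normB _ _))//.
have -> : e * w = e * (x - a) + e * (a + w - x) by ring.
exact: lerD.
Unshelve. all: by end_near. Qed.

Variables (v : R -> R * R) (K : R).
Hypotheses (lip1 : forall s t, `|(v s).1 - (v t).1| <= K * `|s - t|)
           (lip2 : forall s t, `|(v s).2 - (v t).2| <= K * `|s - t|).

Let W1 : W11loc_R (fun s => (v s).1) := lipschitz_W11loc _ _ lip1.
Let W2 : W11loc_R (fun s => (v s).2) := lipschitz_W11loc _ _ lip2.

(** By one-homogeneity its integral over a cell is the increment energy of that cell, so the sums
    become integrals open to dominated convergence. *)
Definition step_integrand G n (x : R) :=
  G (v (round_down n x)) (difference_quotient (fun s => (v s).1) n x,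
                          difference_quotient (fun s => (v s).2) n x).

Lemma measurable_step_integrand G n (D : set R) : sublinear_lagrangian G ->
  measurable D -> measurable_fun D (step_integrand G n).
Proof.
move=> [Gc _ _] mD.
have mr (c : R) : measurable_fun D (fun x => round_down n x + c).
  apply: nondecreasing_measurable => // x y xy; rewrite lerD2r /round_down.
  by rewrite ler_wpM2r// ler_int; apply: le_floor; rewrite ler_wpM2r.
have mv f (c : R) : continuous f -> measurable_fun D (fun x => f (round_down n x + c)).
  move=> cf; apply: (measurableT_comp (f := f)) => //.
  exact: continuous_measurable_fun.
have mv0 f : continuous f -> measurable_fun D (fun x => f (round_down n x)).
  by move=> /(mv f 0); under eq_fun do rewrite addr0.
have mq f : continuous f -> measurable_fun D (difference_quotient f n).
  move=> cf; apply: measurable_funM => //; apply: measurable_funB; [exact: mv|exact: mv0].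
have c1 := W11loc_continuous _ W1; have c2 := W11loc_continuous _ W2.
apply: measurable_fun_continuous4 => //; [|
  exact: (mv0 (fun s => (v s).2))|exact: mq|exact: mq].
exact: (mv0 (fun s => (v s).1)).
Qed.

Lemma step_integrand_bounded G : sublinear_lagrangian G ->
  exists2 C, 0 <= C & forall n x, 0 <= x <= 1 -> `|step_integrand G n x| <= C.
Proof.
move=> GL; have [B _ HB] := W11_box v W1 W2 (-1) 1.
have [C C0 HC] := sublinear_bounded G B GL.
exists (C * (`|K| + `|K|)) => [|n x /andP[x0 x1]].
  by rewrite mulr_ge0// addr_ge0.
have n0 : 0 < n.+1%:R :> R by [].
have /andP[h1 h2] := round_down_itv n x.
have n1 : n.+1%:R^-1 <= 1 :> R by rewrite invf_le1// ler1n.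
have Bv : box B (v (round_down n x)).
  apply: HB; apply/andP; split; last exact: le_trans x1.
  by move: n1 h2; set w := _^-1 => n1 h2; lra.
rewrite (le_trans (HC _ _ Bv))// ler_wpM2l// /l1norm /=.
have dq f : (forall s t, `|f s - f t| <= K * `|s - t|) ->
    `|difference_quotient f n x| <= `|K|.
  move=> lf; rewrite /difference_quotient normrM ger0_norm// mulrC -ler_pdivlMr//.
  rewrite (le_trans (lf _ _))// [_ + _^-1]addrC addrK ger0_norm ?invr_ge0//.
  by rewrite ler_wpM2r ?invr_ge0// ler_norm.
by rewrite lerD// dq.
Qed.

Lemma integrable_step_integrand G n : sublinear_lagrangian G ->
  mu.-integrable `[0, 1] (EFin \o step_integrand G n).
Proof.
move=> GL; have [C C0 HC] := step_integrand_bounded G GL.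
have iC : mu.-integrable `[0, 1] (EFin \o cst C).
  apply: continuous_compact_integrable; first exact: segment_compact.
  by apply: continuous_subspaceT => x; exact: cvg_cst.
apply: le_integrable iC => //.
  apply/measurable_EFinP; exact: (measurable_step_integrand G n _ GL).
by move=> x /=; rewrite in_itv/= => x01; rewrite lee_fin (ger0_norm C0) HC.
Qed.

Lemma discrete_energyE G n : sublinear_lagrangian G ->
  \sum_(i < n.+1) increment_energy G v (grid n i) (grid n i.+1) =
  Rintegral mu `[0, 1] (step_integrand G n).
Proof.
move=> GL; have n0 : 0 < n.+1%:R :> R by [].
have isg := integrable_step_integrand G n GL.
have H N : (N <= n.+1)%N ->
  \sum_(i < N) increment_energy G v (grid n i) (grid n i.+1) =
  Rintegral mu `[0, grid n N] (step_integrand G n).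
  elim: N => [|N IH] Nn.
    by rewrite big_ord0 /grid mul0r set_itv1 Rintegral_set1.
  have gN0 : 0 <= grid n N by rewrite divr_ge0.
  have gNN : grid n N <= grid n N.+1 by rewrite ler_pM2r ?invr_gt0// ler_nat.
  have gN1 : grid n N.+1 <= 1 by rewrite ler_pdivrMr// mul1r ler_nat.
  rewrite big_ord_recr/= IH 1?ltnW//.
  rewrite (Rintegral_chasles _ _ _ _ gN0 gNN); last first.
    exact: integrable_sub isg.
  congr (_ + _).
  have isgN : mu.-integrable `[grid n N, grid n N.+1] (EFin \o step_integrand G n).
    exact: integrable_sub isg.
  have icst : mu.-integrable `[grid n N, grid n N.+1]
      (EFin \o cst (n.+1%:R * increment_energy G v (grid n N) (grid n N.+1))).
    apply: continuous_compact_integrable; first exact: segment_compact.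
    by apply: continuous_subspaceT => x; exact: cvg_cst.
  (* At the right node [round_down] has already jumped to the next cell; the integrand is constant
     on the half-open cell, which has the same integral. *)
  rewrite -Rintegral_itv_bndo_bndc; last first.
    by apply: integrableS isgN => //; apply: subset_itvl; rewrite bnd_simp.
  have gE : grid n N.+1 = grid n N + n.+1%:R^-1 by rewrite /grid -natr1; field.
  rewrite (@eq_Rintegral _ _ _ _ _
    (fun=> n.+1%:R * increment_energy G v (grid n N) (grid n N.+1))); last first.
    move=> x; rewrite inE /= in_itv/= => xN.
    rewrite /step_integrand /difference_quotient (round_down_grid _ _ _ xN).
    case: GL => _ _ GZ.
    by rewrite /increment_energy -GZ//= gE.
  rewrite Rintegral_itv_bndo_bndc; last first.
    by apply: integrableS icst => //; apply: subset_itvl; rewrite bnd_simp.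
  rewrite Rintegral_cst_itv// gE [_ + _^-1]addrC addrK.
  by field.
by rewrite H// /grid divff// gt_eqF.
Qed.

Lemma cvg_discrete_energy G : sublinear_lagrangian G ->
  \sum_(i < n.+1) increment_energy G v (grid n i) (grid n i.+1) @[n --> \oo] -->
  Rintegral mu `[0, 1] (fun t => G (v t) (vel v t)).
Proof.
move=> GL; under eq_fun do rewrite discrete_energyE//.
have [C C0 HC] := step_integrand_bounded G GL.
have iC : mu.-integrable `[0, 1] (EFin \o cst C).
  apply: continuous_compact_integrable; first exact: segment_compact.
  by apply: continuous_subspaceT => x; exact: cvg_cst.
have iG := integrable_energy v W1 W2 G 0 1 GL.
have mI : measurable (`[0, 1]%classic : set R) by exact: measurable_itv.
have Fmu := ae_filter_ringOfSetsType mu.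
have d1 := lipschitz_ae_derivable _ _ 0 1 lip1 ler01.
have d2 := lipschitz_ae_derivable _ _ 0 1 lip2 ler01.
have [||||_ _ H] := @dominated_convergence _ _ _ mu _ mI
  (fun n x => (step_integrand G n x)%:E) (fun x => (G (v x) (vel v x))%:E)
  (fun=> C%:E) _ _ _ iC.
- by move=> n; apply/measurable_EFinP; exact: (measurable_step_integrand G n _ GL).
- exact: (measurable_int mu).
- apply: (filterS2 _ _ d1 d2) => x dx1 dx2; rewrite /= in_itv/= => x01.
  apply: cvg_EFin; first exact: nearW.
  case: GL => Gc _ _.
  have c1 : (v (round_down n x)).1 @[n --> \oo] --> (v x).1.
    exact: (cvg_comp _ _ (cvg_round_down x) (W11loc_continuous _ W1 x)).
  have c2 : (v (round_down n x)).2 @[n --> \oo] --> (v x).2.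
    exact: (cvg_comp _ _ (cvg_round_down x) (W11loc_continuous _ W2 x)).
  have cc : (((v (round_down n x)).1, (v (round_down n x)).2),
      (difference_quotient (fun s => (v s).1) n x,
       difference_quotient (fun s => (v s).2) n x)) @[n --> \oo] -->
      ((((v x).1, (v x).2), vel v x) : (R * R) * (R * R)).
    exact: (cvg_pair (cvg_pair c1 c2)
      (cvg_pair (cvg_difference_quotient _ _ (dx1 x01))
                (cvg_difference_quotient _ _ (dx2 x01)))).
  have {}cc := cvg_comp _ _ cc (Gc (((v x).1, (v x).2), vel v x)).
  have vE t : v t = ((v t).1, (v t).2) by case: (v t).
  rewrite /= -vE in cc; apply: cvg_trans cc; apply: near_eq_cvg.
  by apply: nearW => n; rewrite /= -vE.
- apply: (@filterE _ _ Fmu) => x n; rewrite /= in_itv/= => x01; rewrite lee_fin.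
  exact: HC.
have intE : (\int[mu]_(x in `[0%R, 1%R]) (G (v x) (vel v x))%:E)%E =
    (Rintegral mu `[0, 1] (fun t => G (v t) (vel v t)))%:E.
  by rewrite fineK//; exact: integrable_fin_num.
rewrite intE in H.
by have /fine_cvgP[_] := H.
Qed.

End discrete_energy.

(** * Arclength reparametrization *)

Section reparametrization.
Context {R : realType}.
Notation mu := (@lebesgue_measure R).
Implicit Types (u v : R -> R * R) (G : R * R -> R * R -> R).

Definition l1length u : R := Rintegral mu `[0, 1] (fun t => l1norm (vel u t)).

Section one_curve.
Variable u : R -> R * R.
Hypotheses (W1 : W11loc_R (fun s => (u s).1)) (W2 : W11loc_R (fun s => (u s).2)).

Let w t := 1 + l1norm (vel u t).
Let ell t := Rintegral mu `[0, t] w.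

Let iw (a b : R) : mu.-integrable `[a, b] (EFin \o w).
Proof.
have -> : EFin \o w = ((EFin \o cst 1%R) \+ (EFin \o (fun t => l1norm (vel u t))%R))%E.
  by apply/funext => t /=; rewrite -EFinD.
apply: integrableD => //; last exact: integrable_l1_vel.
apply: continuous_compact_integrable; first exact: segment_compact.
by apply: continuous_subspaceT => x; exact: cvg_cst.
Qed.

Let ell_ge (x y : R) : 0 <= x -> x <= y ->
  y - x + Rintegral mu `[x, y] (fun t => l1norm (vel u t)) = ell y - ell x.
Proof.
move=> x0 xy; rewrite /ell (Rintegral_chasles _ _ _ _ x0 xy)//.
have i1 : mu.-integrable `[x, y] (EFin \o (fun=> 1%R)).
  apply: continuous_compact_integrable; first exact: segment_compact.
  by apply: continuous_subspaceT => t; exact: cvg_cst.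
have il := integrable_l1_vel u W1 W2 x y.
have : Rintegral mu `[x, y] w = Rintegral mu `[x, y] (fun=> 1) +
    Rintegral mu `[x, y] (fun t => l1norm (vel u t)) by exact: RintegralD.
rewrite Rintegral_cst_itv// mul1r => <-.
by rewrite [RHS]addrC addKr.
Qed.

Let l1_ge0 (x y : R) : 0 <= Rintegral mu `[x, y] (fun t => l1norm (vel u t)).
Proof. by apply: Rintegral_ge0 => t _; exact: l1norm_ge0. Qed.

Let ell0 : ell 0 = 0. Proof. by rewrite /ell set_itv1 Rintegral_set1. Qed.

Let ell_incr (x y : R) : 0 <= x -> x <= y -> y - x <= ell y - ell x.
Proof. by move=> x0 xy; rewrite -ell_ge// lerDl l1_ge0. Qed.

Let ell_dist (x y : R) : 0 <= x -> x <= y ->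
  `|(u y).1 - (u x).1| <= ell y - ell x /\ `|(u y).2 - (u x).2| <= ell y - ell x.
Proof.
move=> x0 xy.
have bnd f : W11loc_R f -> (forall t, `|derive1 f t| <= l1norm (vel u t)) ->
    `|f y - f x| <= ell y - ell x.
  move=> Wf fl; apply: le_trans (dist_W11loc _ _ _ Wf xy) _.
  rewrite -ell_ge//; apply: (le_trans (y := Rintegral mu `[x, y] (fun t => l1norm (vel u t)))).
    apply: le_Rintegral => //; [exact: integrable_norm_derive1|exact: integrable_l1_vel].
  by rewrite lerDr subr_ge0.
by split; [apply: (bnd _ W1)|apply: (bnd _ W2)] => t; rewrite /l1norm/= ?lerDl ?lerDr.
Qed.

(* [phi] inverts the normalized weighted arclength t + |u|([0, t]); the term [t]
   makes the latter strictly increasing. *)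
Lemma arclength_reparametrization : exists phi : R -> R,
  [/\ phi 0 = 0, phi 1 = 1, forall s, 0 <= s <= 1 -> 0 <= phi s <= 1 &
   forall s s', 0 <= s -> s <= s' -> s' <= 1 -> phi s <= phi s' /\
     forall t, phi s <= t <= phi s' ->
       `|(u (phi s)).1 - (u t).1| <= (1 + l1length u) * (s' - s) /\
       `|(u (phi s)).2 - (u t).2| <= (1 + l1length u) * (s' - s)].
Proof.
have L1 : ell 1 = 1 + l1length u.
  by rewrite -[LHS]subr0 -ell0 -ell_ge// subr0.
have L0 : 0 < 1 + l1length u by rewrite ltr_wpDr// /l1length l1_ge0.
have ex s : exists t, 0 <= s <= 1 -> 0 <= t <= 1 /\ ell t = s * ell 1.
  have [/andP[s0 s1]|] := boolP (0 <= s <= 1); last by exists 0.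
  have cell := parameterized_integral_continuous ler01 (iw 0 1).
  have [|t t01 tE] := IVT (v := s * ell 1) ler01 cell.
    rewrite /parameterized_integral -/(ell 0) -/(ell 1) ell0 L1.
    have L0' := ltW L0.
    by rewrite min_l// max_r// mulr_ge0//= ler_piMl.
  by exists t => _; split => //; move: t01; rewrite in_itv.
have [phi phiP] := choice ex.
have phi01 s : 0 <= s <= 1 -> 0 <= phi s <= 1 by move=> /phiP[].
have phiE s : 0 <= s <= 1 -> ell (phi s) = s * ell 1 by move=> /phiP[].
have mono s s' : 0 <= s -> s <= s' -> s' <= 1 -> phi s <= phi s'.
  move=> s0 ss s1.
  have h : 0 <= s <= 1 by rewrite s0 (le_trans ss).
  have h' : 0 <= s' <= 1 by rewrite s1 (le_trans s0).
  rewrite leNgt; apply/negP => lt.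
  have := ell_incr (phi s') (phi s) (andP (phi01 _ h')).1 (ltW lt).
  rewrite !phiE// -mulrBl leNgt => /negP; apply.
  rewrite (le_lt_trans (y := 0)) ?subr_gt0//.
  by rewrite pmulr_lle0 ?subr_le0// L1.
exists phi; split => //.
(* [ell] grows at least as fast as the identity, so [ell (phi 0) = 0] forces [phi 0 = 0]; at 1 the
   comparison is made between [phi 1] and 1. *)
- have h : 0 <= (0 : R) <= 1 by rewrite lexx ler01.
  have /andP[p0 _] := phi01 _ h.
  have := ell_incr _ _ (lexx 0) p0; rewrite ell0 phiE// mul0r !subr0 => p1.
  by apply/le_anti; rewrite p0 p1.
- have h : 0 <= (1 : R) <= 1 by rewrite lexx ler01.
  have /andP[p0 p1] := phi01 _ h.
  have := ell_incr _ _ p0 p1; rewrite phiE// mul1r subrr subr_le0 => p2.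
  by apply/le_anti; rewrite p2 p1.
(* The estimate covers every [t] between the two nodes, as the Jensen sums require the oscillation
   on whole cells. *)
- move=> s s' s0 ss s1; split; first exact: mono.
  move=> t /andP[t1 t2].
  have h : 0 <= s <= 1 by rewrite s0 (le_trans ss).
  have h' : 0 <= s' <= 1 by rewrite s1 (le_trans s0).
  have /andP[p0 _] := phi01 _ h.
  have [d1 d2] := ell_dist _ _ p0 t1.
  have : ell t - ell (phi s) <= (1 + l1length u) * (s' - s).
    have t0 := le_trans p0 t1.
    have := ell_incr _ _ t0 t2; rewrite phiE// => h3.
    rewrite phiE// -L1 [leRHS]mulrC mulrBl lerD2r -subr_ge0.
    by apply: le_trans h3; rewrite subr_ge0.
  move=> h3; rewrite [`|(u (phi s)).1 - _|]distrC [`|(u (phi s)).2 - _|]distrC.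
  by split; exact: le_trans h3.
Qed.

End one_curve.

Lemma increment_energy_cvg G (U : set_system nat) {FU : Filter U}
    (un : nat -> R -> R * R) v (s t : R) :
  sublinear_lagrangian G ->
  (un n s).1 @[n --> U] --> (v s).1 -> (un n s).2 @[n --> U] --> (v s).2 ->
  (un n t).1 @[n --> U] --> (v t).1 -> (un n t).2 @[n --> U] --> (v t).2 ->
  increment_energy G (un n) s t @[n --> U] --> increment_energy G v s t.
Proof.
move=> [Gc _ _] s1 s2 t1 t2.
have cc : (((un n s).1, (un n s).2),
    ((un n t).1 - (un n s).1, (un n t).2 - (un n s).2)) @[n --> U] -->
    ((((v s).1, (v s).2), ((v t).1 - (v s).1, (v t).2 - (v s).2)) :
      (R * R) * (R * R)).
  exact: (cvg_pair (cvg_pair s1 s2) (cvg_pair (cvgB t1 s1) (cvgB t2 s2))).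
have {}cc := cvg_comp _ _ cc
  (Gc (((v s).1, (v s).2), ((v t).1 - (v s).1, (v t).2 - (v s).2))).
have vE (z : R * R) : z = (z.1, z.2) by case: z.
rewrite /= -vE in cc; apply: cvg_trans cc; apply: near_eq_cvg.
by apply: nearW => n; rewrite /= -vE.
Qed.

End reparametrization.

(** * Compactness and lower semicontinuity *)

Section compactness.
Context {R : realType}.
Notation mu := (@lebesgue_measure R).
Implicit Types (u v : R -> R * R) (G : R * R -> R * R -> R).

(** Compactness gives a cluster point, which for an ultrafilter is a limit: the preimage of a
    neighbourhood or its complement belongs to [U], and the latter contradicts clustering. *)
Lemma ultrafilter_bounded_cvg (U : set_system nat) (f : nat -> R) (B : R) :
  UltraFilter U -> (forall n, `|f n| <= B) -> exists l : R, f n @[n --> U] --> l.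
Proof.
move=> UU fB; have PU : ProperFilter U by exact: ultra_proper.
have FB : (f @ U) `[- B, B]%classic.
  rewrite /fmap; apply: (@filterE _ U) => n; by have := fB n; rewrite ler_norml /= in_itv.
have [l [_ cl]] := @segment_compact R (- B) B (f @ U) _ FB.
exists l => V Vl; have [//|UnV] := in_ultra_setVsetC (f @^-1` V) UU.
have [x [/= nVx Vx]] := cl (~` V) V UnV Vl.
by [].
Qed.

(** * Periodic extension from the unit interval *)

Definition frac (s : R) : R := s - (Num.floor s)%:~R.

Lemma frac_itv s : 0 <= frac s <= 1.
Proof.
have /andP[h1 h2] := floor_itv s; rewrite intrD1 in h2.
by rewrite /frac; apply/andP; split; lra.
Qed.

Lemma frac_periodic s : frac (s + 1) = frac s.
Proof.
rewrite /frac; have -> : Num.floor (s + 1) = Num.floor s + 1.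
  apply: floor_def; have /andP[h1 h2] := floor_itv s.
  by move: h1 h2; rewrite !intrD1 => h1 h2; apply/andP; split; lra.
by rewrite intrD1; ring.
Qed.

Lemma frac_id (w : R -> R) s : w 0 = w 1 -> 0 <= s <= 1 -> w (frac s) = w s.
Proof.
move=> w01 /andP[s0]; rewrite le_eqVlt => /predU1P[->|s1].
  have -> : frac 1 = 0; last by [].
  by rewrite /frac -[X in Num.floor X](_ : 1%:~R = 1)// intrKfloor subrr.
rewrite /frac (_ : Num.floor s = 0) ?subr0//.
by apply: floor_def; rewrite s0.
Qed.

(** If [s] and [t] have different integer parts, the comparison passes through [w 1 = w 0]: the two
    pieces have total length [1 - frac s + frac t], at most [t - s]. *)
Lemma lipschitz_periodize (w : R -> R) (K : R) : w 0 = w 1 ->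
  (forall s t, 0 <= s -> s <= t -> t <= 1 -> `|w s - w t| <= K * (t - s)) ->
  forall s t, `|w (frac s) - w (frac t)| <= K * `|s - t|.
Proof.
move=> w01 lipw.
have K0 : 0 <= K by have := lipw 0 1 (lexx 0) ler01 (lexx 1); rewrite w01 subrr normr0 subr0 mulr1.
suff H s t : s <= t -> `|w (frac s) - w (frac t)| <= K * (t - s).
  move=> s t; have [st|ts] := leP s t.
    by rewrite [`|s - t|]distrC [`|t - s|]ger0_norm ?subr_ge0// H.
  by rewrite distrC [`|s - t|]gtr0_norm ?subr_gt0// H// ltW.
move=> st; have /andP[s0 s1] := frac_itv s; have /andP[t0 t1] := frac_itv t.
have : Num.floor s <= Num.floor t by exact: le_floor.
rewrite le_eqVlt => /predU1P[fst|flt].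
  have E : frac t - frac s = t - s by rewrite /frac fst; ring.
  by rewrite -E; apply: lipw => //; rewrite -subr_ge0 E subr_ge0.
have E : 1 - frac s + frac t <= t - s.
  have : (Num.floor s + 1)%:~R <= (Num.floor t)%:~R :> R by rewrite ler_int lezD1.
  by rewrite intrD1 /frac; lra.
apply: le_trans (ler_wpM2l K0 E).
have -> : w (frac s) - w (frac t) = (w (frac s) - w 1) + (w 0 - w (frac t)).
  by rewrite w01; ring.
rewrite (le_trans (ler_normD _ _))// mulrDr lerD//; first exact: lipw.
by rewrite -[X in K * X]subr0; exact: lipw.
Qed.

(** The limit [v] is chosen before [G], [c] and [c0], so that one curve serves for [F] and for both
    signs of the area integrand. Bounded starting points keep the curves from drifting to
    infinity. *)
Theorem compactness_lsc (un : nat -> R -> R * R) (B C : R) :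
  (forall n, W11 (un n)) -> (forall n, box B (un n 0)) ->
  (forall n, l1length (un n) <= C) ->
  exists v : R -> R * R, [/\ forall t, v (t + 1) = v t,
    exists K : R, forall s t, `|(v s).1 - (v t).1| <= K * `|s - t| /\
                              `|(v s).2 - (v t).2| <= K * `|s - t| &
    forall G (c : nat -> R) (c0 : R), sublinear_lagrangian G ->
      (forall n, Rintegral mu `[0, 1] (fun t => G (un n t) (vel (un n) t)) <= c n) ->
      c n @[n --> \oo] --> c0 ->
      Rintegral mu `[0, 1] (fun t => G (v t) (vel v t)) <= c0].
Proof.
move=> Wu uB uC.
have W1 n := (Wu n).2.1; have W2 n := (Wu n).2.2.
have [phi phiP] := choice (fun n => arclength_reparametrization (un n) (W1 n) (W2 n)).
(* A common Lipschitz constant: the weighted arclength of [un n] is at most [1 + C]. *)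
pose K := 1 + C.
have C0 : 0 <= C.
  by apply: le_trans (uC 0%N); apply: Rintegral_ge0 => t _; exact: l1norm_ge0.
have K0 : 0 <= K by rewrite addr_ge0.
have osc n s s' t : 0 <= s -> s <= s' -> s' <= 1 -> phi n s <= t <= phi n s' ->
    `|(un n (phi n s)).1 - (un n t).1| <= K * (s' - s) /\
    `|(un n (phi n s)).2 - (un n t).2| <= K * (s' - s).
  move=> s0 ss s1 tP; have [_ _ _ /(_ s s' s0 ss s1)[_ /(_ t tP)]] := phiP n.
  have le1 : (1 + l1length (un n)) * (s' - s) <= K * (s' - s).
    by rewrite ler_wpM2r ?subr_ge0// lerD2l.
  by move=> [h1 h2]; split; apply: le_trans le1.
have phi0 n : phi n 0 = 0 by have [] := phiP n.
have phi1 n : phi n 1 = 1 by have [] := phiP n.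
have mono n s s' : 0 <= s -> s <= s' -> s' <= 1 -> phi n s <= phi n s'.
  by move=> s0 ss s1; have [_ _ _ /(_ s s' s0 ss s1)[]] := phiP n.
pose vn n s := un n (phi n s).
have lipv n s t : 0 <= s -> s <= t -> t <= 1 ->
    `|(vn n s).1 - (vn n t).1| <= K * (t - s) /\
    `|(vn n s).2 - (vn n t).2| <= K * (t - s).
  by move=> s0 st t1; apply: osc => //; apply/andP; split => //; exact: mono.
pose B' := B + K.
have uB' n t : 0 <= t <= 1 -> box B' (un n t).
  move=> t01; have [] := osc n 0 1 t (lexx 0) ler01 (lexx 1).
    by rewrite phi0 phi1.
  rewrite phi0 subr0 mulr1 => h1 h2; have /boxP[b1 b2] := uB n.
  apply/boxP; rewrite /B'; split.
    have -> : (un n t).1 = (un n 0).1 - ((un n 0).1 - (un n t).1) by ring.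
    by rewrite (le_trans (ler_normB _ _))// lerD.
  have -> : (un n t).2 = (un n 0).2 - ((un n 0).2 - (un n t).2) by ring.
  by rewrite (le_trans (ler_normB _ _))// lerD.
have vB n s : 0 <= s <= 1 -> box B' (vn n s).
  by move=> s01; apply: uB'; have [_ _ /(_ s s01)] := phiP n.
have v01 n : vn n 0 = vn n 1.
  by rewrite /vn phi0 phi1 -[1 in RHS]add0r (Wu n).1.
(* All bounded sequences converge along [U], with no choice of subsequence, and limits already known
   along [\oo] persist. *)
have [U [UU subU]] := ultraFilterLemma (@eventually_filter).
have PU : ProperFilter U by exact: ultra_proper.
have ex (pr : R * R -> R) : (forall p, box B' p -> `|pr p| <= B') ->
    (forall n s t, 0 <= s -> s <= t -> t <= 1 ->
      `|pr (vn n s) - pr (vn n t)| <= K * (t - s)) ->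
    exists w : R -> R, [/\ forall s, 0 <= s <= 1 -> pr (vn n s) @[n --> U] --> w s,
      w 0 = w 1 & forall s t, 0 <= s -> s <= t -> t <= 1 -> `|w s - w t| <= K * (t - s)].
  move=> prB prlip.
  have exl s : exists l : R, 0 <= s <= 1 -> pr (vn n s) @[n --> U] --> l.
    have [s01|] := boolP (0 <= s <= 1); last by exists 0.
    have [l cl] := ultrafilter_bounded_cvg U (fun n => pr (vn n s)) B' UU
      (fun n => prB _ (vB n s s01)).
    by exists l.
  have [w wP] := choice exl.
  exists w; split => //.
  - have c0 : pr (vn n 0) @[n --> U] --> w 0 by apply: wP; rewrite lexx ler01.
    have c1 : pr (vn n 1) @[n --> U] --> w 1 by apply: wP; rewrite lexx ler01.
    rewrite (_ : (fun n => pr (vn n 0)) = (fun n => pr (vn n 1))) in c0; last first.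
      by apply/funext => n; rewrite v01.
    exact: (cvg_unique (@Rhausdorff R) c0 c1).
  - move=> s t s0 st t1.
    have s01 : 0 <= s <= 1 by rewrite s0 (le_trans st).
    have t01 : 0 <= t <= 1 by rewrite t1 (le_trans s0).
    have cst : `|pr (vn n s) - pr (vn n t)| @[n --> U] --> `|w s - w t|.
      by apply: cvg_norm; apply: cvgB; exact: wP.
    by apply: (cvgr_to_le cst); apply: nearW => n; exact: prlip.
have [w1 [cw1 w101 lw1]] := ex fst (fun p pB => ((boxP _ _).1 pB).1)
  (fun n s t s0 st t1 => (lipv n s t s0 st t1).1).
have [w2 [cw2 w201 lw2]] := ex snd (fun p pB => ((boxP _ _).1 pB).2)
  (fun n s t s0 st t1 => (lipv n s t s0 st t1).2).
pose v s := (w1 (frac s), w2 (frac s)).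
have lv1 := lipschitz_periodize _ _ w101 lw1.
have lv2 := lipschitz_periodize _ _ w201 lw2.
exists v; split=> [t||]; first by rewrite /v frac_periodic.
  by exists K => s t; split; [exact: lv1|exact: lv2].
move=> G c c0 GL Gc cc0.
have cv1 s : 0 <= s <= 1 -> (vn n s).1 @[n --> U] --> (v s).1.
  by move=> s01; rewrite /v /= frac_id//; exact: cw1.
have cv2 s : 0 <= s <= 1 -> (vn n s).2 @[n --> U] --> (v s).2.
  by move=> s01; rewrite /v /= frac_id//; exact: cw2.
apply/ler_addgt0Pr => e0 e00.
(* The Jensen error [e * C] is then at most [e0]; the added 1 covers [C = 0]. *)
pose e := e0 / (C + 1).
have C10 : 0 < C + 1 by rewrite ltr_wpDl.
have e_gt0 : 0 < e by rewrite divr_gt0.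
have [d d0 Gmod] := sublinear_unif_continuous G B' e GL e_gt0.
have disc := cvg_discrete_energy v K lv1 lv2 G GL.
have dK0 : 0 < d / (K + 1) by rewrite divr_gt0// ltr_wpDl.
(* The mesh is fixed here and [n] goes to the limit along [U] on that mesh; the resulting bound
   [c0 + e0] does not depend on [N]. *)
apply: (cvgr_to_le disc); near=> N.
have N0 : 0 < N.+1%:R :> R by [].
have NK : K * N.+1%:R^-1 <= d.
  have : N.+1%:R^-1 < d / (K + 1).
    by near: N; exact: (near_infty_natSinv_lt (PosNum dK0)).
  rewrite ltr_pdivlMr ?ltr_wpDl// mulrDr mulr1 mulrC => /ltW.
  by apply: le_trans; rewrite lerDl invr_ge0 ltW.
have g0 i : 0 <= grid N i :> R by rewrite divr_ge0.
have gm i : grid N i <= grid N i.+1 :> R by rewrite ler_pM2r ?invr_gt0// ler_nat.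
have g1 i : (i <= N.+1)%N -> grid N i <= 1 :> R.
  by move=> iN; rewrite ler_pdivrMr// mul1r ler_nat.
have gE i : grid N i.+1 - grid N i = N.+1%:R^-1 :> R by rewrite /grid -natr1; field.
have cN : \sum_(i < N.+1) increment_energy G (vn n) (grid N i) (grid N i.+1) @[n --> U] -->
    \sum_(i < N.+1) increment_energy G v (grid N i) (grid N i.+1).
  have : forall m, (m <= N.+1)%N ->
      \sum_(i < m) increment_energy G (vn n) (grid N i) (grid N i.+1) @[n --> U] -->
      \sum_(i < m) increment_energy G v (grid N i) (grid N i.+1).
    elim=> [_|m IH mN].
      by under eq_fun do rewrite big_ord0; rewrite big_ord0; exact: cvg_cst.
    under eq_fun do rewrite big_ord_recr/=; rewrite big_ord_recr/=.
    apply: cvgD; first exact: (IH (ltnW mN)).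
    have h : 0 <= (grid N m : R) <= 1 by rewrite g0 g1// ltnW.
    have h' : 0 <= (grid N m.+1 : R) <= 1 by rewrite g0 g1.
    by apply: increment_energy_cvg => //; [exact: cv1|exact: cv2|exact: cv1|exact: cv2].
  exact.
have cU : c n + e * C @[n --> U] --> c0 + e * C.
  by apply: cvgD; [move=> V /cc0; exact: subU|exact: cvg_cst].
apply: (@le_trans _ _ (c0 + e * C)); last first.
  rewrite lerD2l /e mulrAC ler_pdivrMr// ler_wpM2l// ?lerDl//.
  exact: ltW.
(* At the uniform nodes [vn n] takes the values of [un n] at [phi n (grid N i)], so Jensen is
   applied to [un n] and no derivative of [vn n] is involved. *)
have le0 n : \sum_(i < N.+1) increment_energy G (vn n) (grid N i) (grid N i.+1) <=
    c n + e * C.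
  have := increment_energy_sum_le (un n) (W1 n) (W2 n) G
    (fun i => phi n (grid N i)) N.+1 B' d e GL.
  have -> : phi n (grid N 0) = 0 by rewrite /grid mul0r.
  have -> : phi n (grid N N.+1) = 1 by rewrite /grid divff ?phi1// gt_eqF.
  move=> H; apply: le_trans (H _ _ _ _) _.
  - by move=> i iN; apply: mono => //; apply: g1.
  - by move=> p p' q Bp p1 p2; exact: Gmod.
  - by move=> i iN; apply: vB; rewrite g0 g1// ltnW.
  - move=> i s iN sP; have [h1 h2] := osc n _ _ s (g0 i) (gm i) (g1 _ iN) sP.
    by rewrite gE in h1 h2; split; exact: le_trans NK.
  - apply: lerD; first exact: Gc.
    by apply: ler_wpM2l; [exact: ltW|exact: uC].
have cB : \sum_(i < N.+1) increment_energy G (vn n) (grid N i) (grid N i.+1) -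
    (c n + e * C) @[n --> U] -->
    \sum_(i < N.+1) increment_energy G v (grid N i) (grid N i.+1) - (c0 + e * C).
  exact: cvgB.
by rewrite -subr_le0; apply: (cvgr_to_le cB); apply: nearW => n; rewrite subr_le0.
Unshelve. all: by end_near. Qed.

End compactness.

(** * Energies, areas and translations *)

Section lagrangians.
Context {R : realType}.
Notation mu := (@lebesgue_measure R).
Implicit Types (p q : R * R) (u v : R -> R * R) (G : R * R -> R * R -> R).

Lemma enorm_ge0 q : 0 <= enorm q. Proof. exact: sqrtr_ge0. Qed.

Lemma enorm_le_l1norm q : enorm q <= l1norm q.
Proof.
rewrite /enorm -[leRHS]ger0_norm ?l1norm_ge0// -sqrtr_sqr ler_wsqrtr//.
rewrite /l1norm sqrrD !real_normK ?num_real// lerD2r lerDl.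
by rewrite mulrn_wge0// mulr_ge0.
Qed.

Lemma norm_le_enorm q : `|q.1| <= enorm q /\ `|q.2| <= enorm q.
Proof.
by rewrite /enorm -!sqrtr_sqr; split; rewrite ler_wsqrtr// ?lerDl ?lerDr sqr_ge0.
Qed.

Lemma l1norm_le_enorm q : l1norm q <= 2 * enorm q.
Proof. by have [h1 h2] := norm_le_enorm q; rewrite /l1norm; lra. Qed.

Lemma enorm0 : enorm (0, 0) = 0 :> R.
Proof.
apply/le_anti; rewrite enorm_ge0 (le_trans (enorm_le_l1norm _))//.
by rewrite /l1norm normr0 addr0.
Qed.

(** Convexity at the midpoint of [2 q1] and [2 q2] is subadditivity, once homogeneity removes the
    factors 2. *)
Lemma convex_homogeneous_sublinear G :
  continuous (fun z : (R * R) * (R * R) => G z.1 z.2) ->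
  (forall p q1 q2 (l : R), 0 <= l <= 1 ->
     G p (l * q1.1 + (1 - l) * q2.1, l * q1.2 + (1 - l) * q2.2)
       <= l * G p q1 + (1 - l) * G p q2) ->
  (forall p q (l : R), 0 < l -> G p (l * q.1, l * q.2) = l * G p q) ->
  (forall p, G p (0, 0) = 0) -> sublinear_lagrangian G.
Proof.
move=> Gc Gconv GZ G0; split => // [p q1 q2|p q l].
  have h : 0 <= (2^-1 : R) <= 1 by apply/andP; split; lra.
  have := Gconv p (2 * q1.1, 2 * q1.2) (2 * q2.1, 2 * q2.2) _ h.
  rewrite !GZ//= => H; apply: le_trans (le_trans H _); last by lra.
  by rewrite le_eqVlt; apply/orP; left; apply/eqP; congr (G p (_, _)); field.
rewrite le_eqVlt => /predU1P[<-|l0]; last exact: GZ.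
by rewrite !mul0r G0.
Qed.

(** Writing [q = q' + (q - q')] turns an upper bound into a Lipschitz bound with the same constant,
    which gives [F] and [Finf] a common modulus in [q]. *)
Lemma sublinear_dist_le G (m : R) : sublinear_lagrangian G ->
  (forall p q, G p q <= m * l1norm q) ->
  forall p q q', `|G p q - G p q'| <= m * l1norm (q.1 - q'.1, q.2 - q'.2).
Proof.
move=> [_ GD _] Gm.
suff H p q q' : G p q - G p q' <= m * l1norm (q.1 - q'.1, q.2 - q'.2).
  move=> p q q'; rewrite ler_norml H andbT lerNl opprB.
  have := H p q' q; rewrite /l1norm/=.
  by rewrite [`|q'.1 - _|]distrC [`|q'.2 - _|]distrC.
rewrite lerBlDl; have := GD p q' (q.1 - q'.1, q.2 - q'.2); rewrite /= !subrKC.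
have -> : (q.1, q.2) = q by case: q.
by move=> /le_trans; apply; rewrite lerD2l.
Qed.

(** The integrand of twice [area]; it equals minus the determinant of [(p, q)]. *)
Definition cross p q : R := dotp p (Defs.rot q).

Lemma crossE p q : cross p q = p.2 * q.1 - p.1 * q.2.
Proof. by rewrite /cross /dotp /Defs.rot/=; ring. Qed.

Lemma continuous_cross : continuous (fun z : (R * R) * (R * R) => cross z.1 z.2).
Proof.
have -> : (fun z : (R * R) * (R * R) => cross z.1 z.2) =
    (fun z : (R * R) * (R * R) => z.1.2 * z.2.1 - z.1.1 * z.2.2).
  by apply/funext => z; rewrite crossE.
move=> z.
have c1 : z.1 @[z --> z] --> z.1 by exact: cvg_fst.
have c2 : z.2 @[z --> z] --> z.2 by exact: cvg_snd.
have c11 : z.1.1 @[z --> z] --> z.1.1 by apply: (cvg_comp _ _ c1); exact: cvg_fst.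
have c12 : z.1.2 @[z --> z] --> z.1.2 by apply: (cvg_comp _ _ c1); exact: cvg_snd.
have c21 : z.2.1 @[z --> z] --> z.2.1 by apply: (cvg_comp _ _ c2); exact: cvg_fst.
have c22 : z.2.2 @[z --> z] --> z.2.2 by apply: (cvg_comp _ _ c2); exact: cvg_snd.
by apply: cvgB; apply: cvgM.
Qed.

Lemma sublinear_cross : sublinear_lagrangian cross.
Proof.
split; first exact: continuous_cross.
  by move=> p q1 q2; rewrite !crossE/=; lra.
by move=> p q l _; rewrite !crossE/=; ring.
Qed.

Lemma sublinear_crossN : sublinear_lagrangian (fun p q => - cross p q).
Proof.
split.
- by move=> z; apply: cvgN; exact: continuous_cross.
- by move=> p q1 q2; rewrite !crossE/=; lra.
- by move=> p q l _; rewrite !crossE/=; ring.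
Qed.

Lemma lagrE G u : sublinear_lagrangian G -> W11 u ->
  lagr G u = (Rintegral mu `[0, 1] (fun t => G (u t) (vel u t)))%:E.
Proof.
move=> GL [_ [W1 W2]]; rewrite /lagr /Rintegral fineK//.
by apply: integrable_fin_num => //; exact: integrable_energy.
Qed.

Lemma MtauP tau u : Mtau tau u <->
  W11 u /\ Rintegral mu `[0, 1] (fun t => cross (u t) (vel u t)) = 2 * tau.
Proof.
rewrite /Mtau /=; suff H : W11 u -> area u = tau%:E <->
    Rintegral mu `[0, 1] (fun t => cross (u t) (vel u t)) = 2 * tau.
  by split => -[Wu /(H Wu)].
move=> Wu; rewrite /area.
have := lagrE cross u sublinear_cross Wu; rewrite /lagr /cross => ->.
rewrite -EFinM; split => [[]|->]; last by congr EFin; field.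
by move=> <-; field.
Qed.

Definition translate u (c : R * R) (t : R) : R * R := ((u t).1 + c.1, (u t).2 + c.2).

Lemma derive1_addr (f : R -> R) (c t : R) :
  derive1 (fun s => f s + c) t = derive1 f t.
Proof.
rewrite /derive1; suff -> : (fun h => h^-1 *: (f (h + t) + c - (f t + c))) =
  (fun h => h^-1 *: (f (h + t) - f t)) by [].
by apply/funext => h; congr (_ *: _); ring.
Qed.

Lemma vel_translate u c : vel (translate u c) = vel u.
Proof. by apply/funext => t; rewrite /vel /translate /= !derive1_addr. Qed.

Lemma W11_translate u c : W11 u -> W11 (translate u c).
Proof.
have Wc f (k : R) : W11loc_R f -> W11loc_R (fun s => f s + k).
  move=> Wf a b ab; have [intf fE] := Wf a b ab.
  have -> : derive1 (fun s => f s + k) = derive1 f.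
    by apply/funext => t; exact: derive1_addr.
  by split => //; rewrite -fE; ring.
by move=> [up [W1 W2]]; split; [move=> t; rewrite /translate up|split; exact: Wc].
Qed.

(** Translation adds the integral of [cross c (vel u t)], which is linear in the velocity and
    vanishes because the curve is closed. *)
Lemma Mtau_translate tau u c : Mtau tau u -> Mtau tau (translate u c).
Proof.
move=> /MtauP[Wu Eu]; apply/MtauP; split; first exact: W11_translate.
rewrite -Eu vel_translate; have [up [W1 W2]] := Wu.
have [i1 e1] := W1 0 1 ler01; have [i2 e2] := W2 0 1 ler01.
have u10 : u 1 = u 0 by rewrite -[1 in LHS]add0r up.
rewrite u10 subrr in e1; rewrite u10 subrr in e2.
have iX := integrable_energy u W1 W2 cross 0 1 sublinear_cross.
have iZ (z : R) f : mu.-integrable `[0, 1] (EFin \o f) ->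
    mu.-integrable `[0, 1] (EFin \o (fun t => z * f t)).
  move=> intf; have := integrableZl _ z intf.
  have -> : (fun x => z%:E * (EFin \o f) x)%E = (EFin \o (fun t => z * f t)).
    by apply/funext => t /=; rewrite EFinM.
  exact.
have j1 := iZ c.2 _ i1; have j2 := iZ (- c.1) _ i2.
have j12 : mu.-integrable `[0, 1] (EFin \o (fun t =>
    c.2 * derive1 (fun s => (u s).1) t + - c.1 * derive1 (fun s => (u s).2) t)).
  have := integrableD _ j1 j2; rewrite (_ : (_ \+ _)%E = (EFin \o (fun t =>
    c.2 * derive1 (fun s => (u s).1) t + - c.1 * derive1 (fun s => (u s).2) t))); last first.
    by apply/funext => t /=; rewrite EFinD.
  exact.
transitivity (Rintegral mu `[0, 1] (fun t => cross (u t) (vel u t) +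
    (c.2 * derive1 (fun s => (u s).1) t + - c.1 * derive1 (fun s => (u s).2) t))).
  by apply: eq_Rintegral => t _; rewrite !crossE /=; ring.
have -> : Rintegral mu `[0, 1] (fun t => cross (u t) (vel u t) +
    (c.2 * derive1 (fun s => (u s).1) t + - c.1 * derive1 (fun s => (u s).2) t)) =
  Rintegral mu `[0, 1] (fun t => cross (u t) (vel u t)) +
  Rintegral mu `[0, 1] (fun t =>
    c.2 * derive1 (fun s => (u s).1) t + - c.1 * derive1 (fun s => (u s).2) t).
  exact: RintegralD.
have -> : Rintegral mu `[0, 1] (fun t =>
    c.2 * derive1 (fun s => (u s).1) t + - c.1 * derive1 (fun s => (u s).2) t) =
  Rintegral mu `[0, 1] (fun t => c.2 * derive1 (fun s => (u s).1) t) +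
  Rintegral mu `[0, 1] (fun t => - c.1 * derive1 (fun s => (u s).2) t).
  exact: RintegralD.
by rewrite !RintegralZl// -e1 -e2 !mulr0 !addr0.
Qed.

Lemma energy_le_add G H u (e : R) : W11 u ->
  sublinear_lagrangian G -> sublinear_lagrangian H ->
  (forall t q, 0 <= t <= 1 -> G (u t) q <= H (u t) q + e * l1norm q) ->
  Rintegral mu `[0, 1] (fun t => G (u t) (vel u t)) <=
  Rintegral mu `[0, 1] (fun t => H (u t) (vel u t)) + e * l1length u.
Proof.
move=> [_ [W1 W2]] GL HL GH.
have iG := integrable_energy u W1 W2 G 0 1 GL.
have iH := integrable_energy u W1 W2 H 0 1 HL.
have il := integrable_l1_vel u W1 W2 0 1.
have iel : mu.-integrable `[0, 1] (EFin \o (fun t => e * l1norm (vel u t))).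
  have := integrableZl _ e il; rewrite (_ : (fun x => _) =
    (EFin \o (fun t => e * l1norm (vel u t)))); last first.
    by apply/funext => t /=; rewrite EFinM.
  exact.
rewrite /l1length -RintegralZl// -RintegralD//.
apply: le_Rintegral => //.
  have := integrableD _ iH iel; rewrite (_ : (_ \+ _)%E = (EFin \o
    (fun t => H (u t) (vel u t) + e * l1norm (vel u t)))); last first.
    by apply/funext => t /=; rewrite EFinD.
  exact.
by move=> t; rewrite /= in_itv/= => t01; exact: GH.
Qed.

End lagrangians.

(** * The Lagrangian at infinity *)

Section lagrangian_at_infinity.
Context {R : realType}.
Notation mu := (@lebesgue_measure R).
Variables (F Finf : R * R -> R * R -> R) (m1 m2 : R).
Hypotheses (Fc : continuous (fun z : (R * R) * (R * R) => F z.1 z.2))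
  (Fconv : forall p q1 q2 (l : R), 0 <= l <= 1 ->
     F p (l * q1.1 + (1 - l) * q2.1, l * q1.2 + (1 - l) * q2.2)
       <= l * F p q1 + (1 - l) * F p q2)
  (FZ : forall p q (l : R), 0 < l -> F p (l * q.1, l * q.2) = l * F p q)
  (m1_gt0 : 0 < m1) (m2_gt0 : 0 < m2)
  (Fm : forall p q, m1 * enorm q <= F p q /\ F p q <= m2 * enorm q)
  (Finfc : continuous (fun z : (R * R) * (R * R) => Finf z.1 z.2))
  (Finf_per : forall p q (n1 n2 : int),
     Finf (p.1 + n1%:~R, p.2 + n2%:~R) q = Finf p q)
  (FFinf : forall q (e : R), 0 < e -> exists M : R, forall p,
     M < enorm p -> `|F p q - Finf p q| < e).

(** An integer translation along the first axis: by periodicity it leaves [Finf] unchanged, and it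
    carries bounded sets to infinity. *)
Let far (n : nat) (p : R * R) : R * R := (p.1 + n%:R, p.2).

Let Finf_far n p q : Finf (far n p) q = Finf p q.
Proof. by have := Finf_per p q n%:Z 0; rewrite mulr0z addr0. Qed.

Let far_enorm (B M : R) : exists n, forall p, box B p -> M < enorm (far n p).
Proof.
exists (Num.bound (`|B| + `|M|)) => p /boxP[p1 _].
apply: lt_le_trans (norm_le_enorm _).1; rewrite /far/=.
have : `|B| + `|M| < (Num.bound (`|B| + `|M|))%:R.
  by apply: archi_boundP; rewrite addr_ge0.
set n := _%:R => nB.
have := ler_norm (p.1 + n); have := ler_norm (- p.1); have := ler_norm M.
have := ler_norm B; rewrite normrN; lra.
Qed.

Let F_far_cvg p q : F (far n p) q @[n --> \oo] --> Finf p q.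
Proof.
apply/cvgrPdist_lt => e e0; have [M HM] := FFinf q e e0.
near=> n; rewrite distrC -(Finf_far n); apply: HM.
apply: lt_le_trans (norm_le_enorm _).1; rewrite /far/=.
have : `|p.1| + `|M| < n%:R by near: n; exact: nbhs_infty_gtr.
have := ler_norm (p.1 + n%:R); have := ler_norm (- p.1); have := ler_norm M.
rewrite normrN; lra.
Unshelve. all: by end_near. Qed.

Let FL : sublinear_lagrangian F.
Proof.
apply: convex_homogeneous_sublinear => // p.
have [h1 h2] := Fm p (0, 0); apply/le_anti.
by rewrite enorm0 !mulr0 in h1 h2; rewrite h1 h2.
Qed.

(** [Finf] is the pointwise limit of [F] along [far]; subadditivity and homogeneity pass to the
    limit. *)
Let FinfL : sublinear_lagrangian Finf.
Proof.
have [_ FD FZ0] := FL; split => // [p q1 q2|p q l l0].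
  have cD : F (far n p) q1 + F (far n p) q2 - F (far n p) (q1.1 + q2.1, q1.2 + q2.2)
      @[n --> \oo] --> Finf p q1 + Finf p q2 - Finf p (q1.1 + q2.1, q1.2 + q2.2).
    by apply: cvgB; [apply: cvgD|]; exact: F_far_cvg.
  by rewrite -subr_ge0; apply: (cvgr_to_ge cD); apply: nearW => n; rewrite subr_ge0.
have c1 : l * F (far n p) q @[n --> \oo] --> l * Finf p q.
  by apply: cvgM; [exact: cvg_cst|exact: F_far_cvg].
have c2 := F_far_cvg p (l * q.1, l * q.2).
rewrite (_ : (fun n => _) = (fun n => l * F (far n p) q)) in c2; last first.
  by apply/funext => n; exact: FZ0.
exact: (cvg_unique (@Rhausdorff R) c2 c1).
Qed.

Let F_le p q : F p q <= m2 * l1norm q.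
Proof. by apply: le_trans (Fm p q).2 _; rewrite ler_pM2l// enorm_le_l1norm. Qed.

Let Finf_le p q : Finf p q <= m2 * l1norm q.
Proof. by apply: (cvgr_to_le (F_far_cvg p q)); apply: nearW => n. Qed.

(** The hypothesis is pointwise in [q]. The common Lipschitz constant [m2] of [F p] and [Finf p]
    makes it uniform on the compact unit box, and homogeneity extends it to all [q]. *)
Let F_Finf_unif (e : R) : 0 < e -> exists M : R, forall p q, M < enorm p ->
  `|F p q - Finf p q| <= l1norm q * e.
Proof.
move=> e0.
have /compact_near_coveringP cpt := @compact_box R 1.
pose P (M : R) q := forall p, M < enorm p -> `|F p q - Finf p q| <= e.
have H : \forall M \near +oo, box 1 `<=` P M.
  apply: cpt => q0 _.
  have [M0 HM0] := FFinf q0 (e / 3) (divr_gt0 e0 (ltr0Sn _ _)).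
  (* Two coordinates within [e / (6 * m2)] and the Lipschitz constant [m2] give [e / 3], one third
     of the tolerance for each of three terms. *)
  have r0 : 0 < e / (6 * m2) by rewrite divr_gt0// mulr_gt0.
  exists (ball q0 (e / (6 * m2)), [set x | M0 < x]) => /=.
    by split; [exact: nbhsx_ballx|apply: nbhs_pinfty_gt; rewrite num_real].
  move=> [q M] /= [[b1 b2] MM] p Mp.
  have l1q : m2 * l1norm (q.1 - q0.1, q.2 - q0.2) <= e / 3.
    have h1 : `|q.1 - q0.1| <= e / (6 * m2).
      by move: b1; rewrite -ball_normE /ball_ /= distrC => /ltW.
    have h2 : `|q.2 - q0.2| <= e / (6 * m2).
      by move: b2; rewrite -ball_normE /ball_ /= distrC => /ltW.
    have -> : e / 3 = m2 * (e / (6 * m2) + e / (6 * m2)) by field; rewrite gt_eqF.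
    by rewrite ler_pM2l// /l1norm lerD.
  have a1 := le_trans (sublinear_dist_le F m2 FL F_le p q q0) l1q.
  have a2 := le_trans (sublinear_dist_le Finf m2 FinfL Finf_le p q q0) l1q.
  have a3 := ltW (HM0 p (lt_trans MM Mp)).
  have -> : F p q - Finf p q =
    (F p q - F p q0) + (F p q0 - Finf p q0) - (Finf p q - Finf p q0) by ring.
  rewrite (le_trans (ler_normB _ _))//.
  have := ler_normD (F p q - F p q0) (F p q0 - Finf p q0); lra.
have [M HM] : exists M : R, box 1 `<=` P M by exact: filter_ex H.
exists M => p q Mp.
have [_ _ FZ0] := FL; have [_ _ FinfZ0] := FinfL.
apply: (box_scale (fun q c => `|F p q - Finf p q| <= c)) => [l q' c l0 h|q' bq'].
  by rewrite FZ0// FinfZ0// -mulrBr normrM (ger0_norm l0) ler_wpM2l.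
exact: HM.
Qed.

Let l1length_ge0 u : 0 <= @l1length R u.
Proof. by apply: Rintegral_ge0 => t _; exact: l1norm_ge0. Qed.

Lemma Sval_le_Sval_infinity (tau : R) : (Sval F tau <= Sval Finf tau)%E.
Proof.
apply: le_ereal_inf_tmp => _ [u Mu <-].
have [Wu _] := (MtauP tau u).1 Mu; have [_ [W1 W2]] := Wu.
rewrite (lagrE Finf)//; apply/lee_addgt0Pr => e e0.
have L0 : 0 < l1length u + 1 by rewrite ltr_wpDl ?l1length_ge0.
(* With this tolerance the error integrated along [u] is at most [e]; the added 1 covers curves of
   zero length. *)
have [M HM] := F_Finf_unif (e / (l1length u + 1)) (divr_gt0 e0 L0).
have [B _ HB] := W11_box u W1 W2 0 1.
have [n Hn] := far_enorm B M.
pose un := translate u (n%:R, 0).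
have Mun : Mtau tau un by exact: Mtau_translate.
apply: (@le_trans _ _ (lagr F un)); first by apply: ereal_inf_lbound; exists un.
have Wun := W11_translate u (n%:R, 0) Wu.
rewrite (lagrE F)// -EFinD lee_fin.
have unE t : un t = far n (u t) by rewrite /un /translate /far/= addr0.
apply: (@le_trans _ _ (Rintegral mu `[0, 1] (fun t => Finf (un t) (vel un t)) +
   (e / (l1length u + 1)) * l1length un)).
  apply: energy_le_add => // t q t01; rewrite unE.
  have := HM (far n (u t)) q (Hn _ (HB t t01)).
  by rewrite ler_norml => /andP[_]; rewrite lerBlDl mulrC.
rewrite /l1length /un vel_translate -/un -/(l1length u) lerD//.
  rewrite le_eqVlt; apply/orP; left; apply/eqP.
  by apply: eq_Rintegral => t _; rewrite unE Finf_far.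
by rewrite mulrAC ler_pdivrMr// ler_wpM2l ?ltW// ltrDl.
Qed.

(** The factor 2 compares [l1norm] with [enorm]; coercivity contributes [1 / m1]. *)
Let length_le_energy u : W11 u ->
  l1length u <= 2 / m1 * Rintegral mu `[0, 1] (fun t => F (u t) (vel u t)).
Proof.
move=> [_ [W1 W2]]; have iF := integrable_energy u W1 W2 F 0 1 FL.
have il := integrable_l1_vel u W1 W2 0 1.
have iZ : mu.-integrable `[0, 1] (EFin \o (fun t => 2 / m1 * F (u t) (vel u t))).
  have := integrableZl _ (2 / m1) iF; rewrite (_ : (fun x => _) =
    (EFin \o (fun t => 2 / m1 * F (u t) (vel u t)))); last first.
    by apply/funext => t /=; rewrite EFinM.
  exact.
rewrite /l1length -RintegralZl//; apply: le_Rintegral => // t _.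
apply: le_trans (l1norm_le_enorm _) _.
by rewrite mulrAC ler_pdivlMr// -mulrA ler_pM2l// mulrC (Fm _ _).1.
Qed.

(** Along a curve staying beyond [M], replacing [F] by [Finf] costs at most [h], so the
    [Finf]-energy would be at most [s + 2 * h], below [Sval Finf tau]. Hence the curve comes within
    [M] of the origin, and its length, at most [C], keeps both coordinates of [u 0] within
    [M + C]. *)
Lemma near_minimizer_bounded (tau s h : R) : 0 <= s -> 0 < h ->
  ((s + 2 * h)%:E < Sval Finf tau)%E ->
  exists B, forall u, Mtau tau u ->
    Rintegral mu `[0, 1] (fun t => F (u t) (vel u t)) <= s + h -> box B (u 0).
Proof.
move=> s0 h0 sinf; pose C := 2 / m1 * (s + h).
have C0 : 0 <= C by rewrite mulr_ge0// ?divr_ge0// ?addr_ge0// ltW.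
have C10 : 0 < C + 1 by rewrite ltr_wpDl.
have [M HM] := F_Finf_unif (h / (C + 1)) (divr_gt0 h0 C10).
exists (M + C) => u Mu uF.
have [Wu _] := (MtauP tau u).1 Mu; have [_ [W1 W2]] := Wu.
have uC : l1length u <= C.
  by apply: le_trans (length_le_energy u Wu) _; rewrite ler_wpM2l// divr_ge0// ltW.
have [[t [t01 tM]]|Nt] := pselect (exists t, 0 <= t <= 1 /\ enorm (u t) <= M).
  have [t1 t2] := norm_le_enorm (u t); have /andP[t0 t1'] := t01.
  have bnd f : W11loc_R f -> (forall r, `|derive1 f r| <= l1norm (vel u r)) ->
      `|f t| <= M -> `|f 0| <= M + C.
    move=> Wf fl fM.
    have : `|f t - f 0| <= C.
      apply: le_trans (dist_W11loc _ _ _ Wf t0) _; apply: le_trans uC.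
      rewrite /l1length (Rintegral_chasles _ _ _ _ t0 t1'); last exact: integrable_l1_vel.
      rewrite -[leLHS]addr0 lerD//; last first.
        by apply: Rintegral_ge0 => r _; exact: l1norm_ge0.
      by apply: le_Rintegral => //; [exact: integrable_norm_derive1|exact: integrable_l1_vel].
    move=> fC; have -> : f 0 = f t - (f t - f 0) by ring.
    by rewrite (le_trans (ler_normB _ _))// lerD.
  apply/boxP; split.
    by apply: (bnd _ W1) => [r|]; [rewrite /l1norm lerDl|exact: le_trans tM].
  by apply: (bnd _ W2) => [r|]; [rewrite /l1norm lerDr|exact: le_trans tM].
have : (Sval Finf tau <= (s + 2 * h)%:E)%E.
  apply: (@le_trans _ _ (lagr Finf u)); first by apply: ereal_inf_lbound; exists u.
  rewrite (lagrE Finf)// lee_fin.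
  apply: (@le_trans _ _ (Rintegral mu `[0, 1] (fun t => F (u t) (vel u t)) +
    h / (C + 1) * l1length u)).
    apply: energy_le_add => // t q t01.
    have Mt : M < enorm (u t) by rewrite ltNge; apply/negP => tM; apply: Nt; exists t.
    have := HM (u t) q Mt.
    rewrite ler_norml => /andP[h1 _].
    by rewrite -[h / (C + 1) * _]mulrC; lra.
  have : h / (C + 1) * l1length u <= h.
    rewrite mulrAC ler_pdivrMr// ler_pM2l// (le_trans uC)// lerDl//.
  by move: uF; lra.
by rewrite leNgt sinf.
Qed.

Lemma minimizer_exists (tau : R) : (Sval F tau < Sval Finf tau)%E ->
  exists u, Mtau tau u /\ lipschitz_curve u /\ lagr F u = Sval F tau.
Proof.
move=> lt.
have Rint0 u : 0 <= Rintegral mu `[0, 1] (fun t => F (u t) (vel u t)).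
  apply: Rintegral_ge0 => t _; apply: le_trans (Fm _ _).1.
  by rewrite mulr_ge0// ?enorm_ge0// ltW.
have S0 : (0 <= Sval F tau)%E.
  apply: le_ereal_inf_tmp => _ [u Mu <-].
  by rewrite (lagrE F)// ?lee_fin//; have [] := (MtauP tau u).1 Mu.
have Sfin : Sval F tau \is a fin_num.
  by rewrite ge0_fin_numE// (lt_le_trans lt)// leey.
pose s := fine (Sval F tau).
have sE : Sval F tau = s%:E by rewrite /s fineK.
have s0 : 0 <= s by rewrite -lee_fin -sE.
(* A quarter of the gap leaves [s + 2 * h] strictly inside it; if [Sval Finf tau] is infinite, any
   positive [h] will do. *)
have [h h0 hinf] : exists2 h : R, 0 < h & ((s + 2 * h)%:E < Sval Finf tau)%E.
  rewrite sE in lt; move: lt; case: (Sval Finf tau) => [r|_|//].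
    rewrite lte_fin => sr; exists ((r - s) / 4); first by rewrite divr_gt0// subr_gt0.
    by rewrite lte_fin; lra.
  by exists 1 => //; rewrite ltry.
have [B HB] := near_minimizer_bounded tau s h s0 h0 hinf.
(* The excess [h / (n+1)] tends to 0 and never exceeds [h], so [near_minimizer_bounded] applies to
   every term. *)
have ex (n : nat) : exists u, Mtau tau u /\
    Rintegral mu `[0, 1] (fun t => F (u t) (vel u t)) <= s + h * n.+1%:R^-1.
  have hn : 0 < h * n.+1%:R^-1 by rewrite mulr_gt0 ?invr_gt0.
  have [_ [u Mu <-] uS] := lb_ereal_inf_adherent hn Sfin.
  exists u; split => //; move: uS; rewrite -/(Sval F tau) sE (lagrE F)//.
    by rewrite -EFinD lte_fin => /ltW.
  by have [] := (MtauP tau u).1 Mu.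
have [un unP] := choice ex.
have unF n : Rintegral mu `[0, 1] (fun t => F (un n t) (vel (un n) t)) <= s + h.
  apply: le_trans (unP n).2 _; rewrite lerD2l ler_piMr//; first exact: ltW.
  by rewrite invf_le1// ler1n.
have Wun n : W11 (un n) by have [] := (MtauP tau _).1 (unP n).1.
have [||v [vper [K lipv] lsc]] := compactness_lsc un B (2 / m1 * (s + h)) Wun.
- by move=> n; apply: HB (unF n); exact: (unP n).1.
- move=> n; apply: le_trans (length_le_energy _ (Wun n)) _.
  by rewrite ler_wpM2l// divr_ge0// ltW.
have W1 := lipschitz_W11loc (fun s => (v s).1) K (fun s t => (lipv s t).1).
have W2 := lipschitz_W11loc (fun s => (v s).2) K (fun s t => (lipv s t).2).
have Wv : W11 v by [].
have Eun n := ((MtauP tau _).1 (unP n).1).2.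
have ccst (c : R) : (fun _ : nat => c) n @[n --> \oo] --> c by exact: cvg_cst.
have Rnegcross u : W11 u -> Rintegral mu `[0, 1] (fun t => - cross (u t) (vel u t)) =
    - Rintegral mu `[0, 1] (fun t => cross (u t) (vel u t)).
  move=> [_ [U1 U2]].
  have iX := integrable_energy u U1 U2 cross 0 1 sublinear_cross.
  by rewrite -mulN1r -RintegralZl//; apply: eq_Rintegral => t _; rewrite mulN1r.
(* The constant bounds [2 * tau] and [- (2 * tau)] are fed to [lsc] for the two signs of [cross];
   together they give equality. *)
have Ev : Rintegral mu `[0, 1] (fun t => cross (v t) (vel v t)) = 2 * tau.
  apply/le_anti/andP; split.
    apply: (lsc cross (fun=> 2 * tau) _ sublinear_cross _ (ccst _)) => n.
    by rewrite Eun.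
  rewrite -lerN2 -Rnegcross//.
  apply: (lsc (fun p q => - cross p q) (fun=> - (2 * tau)) _ sublinear_crossN _ (ccst _)) => n.
  by rewrite (Rnegcross _ (Wun n)) Eun.
have Mv : Mtau tau v by apply/MtauP.
exists v; split => //; split.
  exists (2 * K) => a b; apply: le_trans (enorm_le_l1norm _) _.
  by have [l1 l2] := lipv a b; rewrite /l1norm/= -mulrA; lra.
apply/le_anti/andP; split; last by apply: ereal_inf_lbound; exists v.
rewrite (lagrE F)// sE lee_fin.
apply: (lsc F (fun n => s + h * n.+1%:R^-1)) => //; first by move=> n; exact: (unP n).2.
rewrite -[X in _ --> X]addr0 -[X in _ --> _ + X](mulr0 h).
apply: cvgD; first exact: cvg_cst.
by apply: cvgM; [exact: cvg_cst|exact: cvg_harmonic].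
Qed.

End lagrangian_at_infinity.

Theorem theorem1p2p2 (R : realType) (F Finf : R * R -> R * R -> R) :
  continuous (fun z : (R * R) * (R * R) => F z.1 z.2) ->
  (forall p q1 q2 (l : R), 0 <= l <= 1 ->
     F p (l * q1.1 + (1 - l) * q2.1, l * q1.2 + (1 - l) * q2.2)
       <= l * F p q1 + (1 - l) * F p q2) ->
  (forall p q (l : R), 0 < l -> F p (l * q.1, l * q.2) = l * F p q) ->
  (exists m1 m2 : R, 0 < m1 /\ 0 < m2 /\
     forall p q, m1 * enorm q <= F p q /\ F p q <= m2 * enorm q) ->
  continuous (fun z : (R * R) * (R * R) => Finf z.1 z.2) ->
  (forall p q (n1 n2 : int), Finf (p.1 + n1%:~R, p.2 + n2%:~R) q = Finf p q) ->
  (forall q (e : R), 0 < e -> exists M : R, forall p,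
     M < enorm p -> `|F p q - Finf p q| < e) ->
  (forall tau : R, (Sval F tau <= Sval Finf tau)%E) /\
  (forall tau : R, (Sval F tau < Sval Finf tau)%E ->
     exists u, Mtau tau u /\ lipschitz_curve u /\ lagr F u = Sval F tau).
Proof.
move=> Fc Fconv FZ [m1 [m2 [m1_gt0 [m2_gt0 Fm]]]] Finfc Finf_per FFinf.
split => tau; first exact: (Sval_le_Sval_infinity F Finf m1 m2).
exact: (minimizer_exists F Finf m1 m2).
Qed.
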